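(* Let $k$ be a commutative associative unital ring with $1/2,1/3\in k$ and let $J$ be an Albert algebra over $k$. Then the Lie algebra $\mathrm{TKK}(J)$ is centrally closed, i.e., the canonical map $u:\mathfrak{uce}(\mathrm{TKK}(J))\to\mathrm{TKK}(J)$ is an isomorphism.
   Context: The split octonion algebra $Z$ over a ring $K$ is the set of matrices $\begin{pmatrix} \alpha_1 & u \\ x & \alpha_2 \end{pmatrix}$ with $\alpha_1,\alpha_2\in K$, $u,x\in K^3$, with multiplication $$\begin{pmatrix} \alpha_1 & u \\ x & \alpha_2 \end{pmatrix}\begin{pmatrix} \beta_1 & v \\ y & \beta_2 \end{pmatrix}=\begin{pmatrix} \alpha_1\beta_1-u\cdot y & \alpha_1v+\beta_2u+x\times y \\ \beta_1x+\alpha_2y+u\times v & \alpha_2\beta_2-x\cdot v \end{pmatrix}$$ and involution $\bar z=t(z)1-z$, $t(z)=\alpha_1+\alpha_2$. The split Albert algebra over $K$ is the Jordan algebra $\mathcal H_3(Z,\bar{\ })$ of $3\times3$ matrices $A$ over $Z$ with $\bar A^T=A$ and diagonal entries in $K1$, with product $\tfrac12(AB+BA)$. A Jordan algebra $J$ over $k$ is an Albert algebra if there is a faithfully flat extension $k\to K$ such that $J\otimes_kK$ is isomorphic to the split Albert algebra over $K$. For a unital Jordan algebra $J$ over $k\ni1/2$ with product $ab$, put $\{a\,b\,c\}=2(a(bc)+c(ba)-b(ca))$, let $\mathbf J=(\mathbf J^+,\mathbf J^-)=(J,J)$, $\delta(x,y)=(z\mapsto\{x\,y\,z\},\;w\mapsto-\{y\,x\,w\})\in\mathrm{End}(\mathbf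 J^+)\times\mathrm{End}(\mathbf J^-)$, and $\mathfrak{ider}(\mathbf J)=\mathrm{span}\{\delta(x,y)\}$. $\mathrm{TKK}(J)=\mathbf J^+\oplus\mathfrak{ider}(\mathbf J)\oplus\mathbf J^-$ is the Lie algebra with $[\mathbf J^\pm,\mathbf J^\pm]=0$, $[x,y]=\delta(x,y)$ ($x\in\mathbf J^+$, $y\in\mathbf J^-$), $[T,v]=T(v)$, and the commutator on $\mathfrak{ider}(\mathbf J)$. $\mathfrak{uce}(L)=(L\wedge L)/\mathcal B$, $\mathcal B$ spanned by $x\wedge[y,z]+y\wedge[z,x]+z\wedge[x,y]$, with $\langle x,y\rangle$ the class of $x\wedge y$, $u(\langle x,y\rangle)=[x,y]$ and bracket $[X,Y]=\langle u(X),u(Y)\rangle$; for perfect $L$ this is the universal central extension. *)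

(* Defs.v *)
From HB Require Import structures.
From mathcomp Require Import all_boot all_order all_algebra ring.
From mathcomp Require Import all_classical.

Set Implicit Arguments.
Unset Strict Implicit.
Unset Printing Implicit Defensive.

Import GRing.Theory.
Local Open Scope ring_scope.
Local Open Scope quotient_scope.

Reserved Notation "a ** b" (at level 40, left associativity).
Reserved Notation "m ⊗ n" (at level 40, left associativity).

Section Span.
Variables (k : comPzRingType) (V : lmodType k).
Implicit Type S : V -> Prop.

Inductive lin_span S : V -> Prop :=
| span_0 : lin_span S 0
| span_ZD a x y : S x -> lin_span S y -> lin_span S (a *: x + y).

Definition in_span S : V -> bool := fun v => `[< lin_span S v >].

Lemma span_gen S x : S x -> lin_span S x.
Proof.
by move=> Sx; rewrite -[x]scale1r -[_ *: _]addr0; apply: span_ZD => //; exact: span_0.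
Qed.

Lemma spanD S x y : lin_span S x -> lin_span S y -> lin_span S (x + y).
Proof. by elim=> [|a u v Su _ IH] Sy; rewrite ?add0r // -addrA; apply: span_ZD; auto. Qed.

Lemma spanZ S a x : lin_span S x -> lin_span S (a *: x).
Proof.
elim=> [|b u v Su _ IH]; first by rewrite scaler0; exact: span_0.
by rewrite scalerDr scalerA; apply: span_ZD.
Qed.

Lemma in_span_closed S : GRing.subsemimod_closed (in_span S).
Proof.
split; first split; first by apply/asboolP; exact: span_0.
  by move=> x y /asboolP Sx /asboolP Sy; apply/asboolP; exact: spanD.
by move=> a x /asboolP Sx; apply/asboolP; exact: spanZ.
Qed.

HB.instance Definition _ S := GRing.isSubmodClosed.Build k V (in_span S) (in_span_closed S).

Local Notation quotz S := (Quotient.quot (GRing.ZmodClosed.clone V (in_span S) _)).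

(* V modulo the submodule spanned by S. *)
Definition quot_module S : Type := quotz S.

HB.instance Definition _ S := GRing.Zmodule.on (quot_module S).

Definition qpi S (v : V) : quot_module S := \pi_(quotz S) v.

(* Only meaningful if f is linear and vanishes on S, see qliftE and qlift_linear;
   the same pattern is used for tlift below. *)
Definition qlift S (W : Type) (f : V -> W) (q : quot_module S) : W :=
  f (repr (q : quotz S)).

Lemma qpiP S v w : (qpi S v = qpi S w) <-> lin_span S (v - w).
Proof.
rewrite /qpi; split => [/eqP|h].
  by rewrite -Quotient.idealrBE => /asboolP.
by apply/eqP; rewrite -Quotient.idealrBE; apply/asboolP.
Qed.

Lemma qpi_surj S (q : quot_module S) : exists v, q = qpi S v.
Proof. by exists (repr (q : quotz S)); rewrite /qpi reprK. Qed.

Lemma qpiD S v w : qpi S (v + w) = qpi S v + qpi S w.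
Proof. by rewrite /qpi raddfD. Qed.

Lemma qliftE S (W : lmodType k) (f : V -> W) : linear f -> (forall v, S v -> f v = 0) ->
  forall v, qlift f (qpi S v) = f v.
Proof.
move=> lf f0 v; rewrite /qlift; set w := repr _.
have /qpiP : qpi S w = qpi S v by rewrite /w /qpi reprK.
have f00 : f 0 = 0 by have := lf (-1) 0 0; rewrite scaler0 addr0 scaleN1r addNr.
move=> h; have : f (w - v) = 0.
  by elim: h => // a x y Sx _ IH; rewrite lf f0 // IH scaler0 addr0.
have -> : w - v = (-1) *: v + w by rewrite scaleN1r addrC.
by rewrite lf scaleN1r addrC => /eqP; rewrite subr_eq0 => /eqP.
Qed.

Definition qscale S a : quot_module S -> quot_module S := qlift (fun v => qpi S (a *: v)).

Lemma qscaleE S a v : qscale a (qpi S v) = qpi S (a *: v).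
Proof.
rewrite /qscale /qlift; set w := repr _.
have /qpiP h : qpi S w = qpi S v by rewrite /w /qpi reprK.
by apply/qpiP; rewrite -scalerBr; exact: spanZ.
Qed.

Fact qscaleA S a b (q : quot_module S) : qscale a (qscale b q) = qscale (a * b) q.
Proof. by have [v ->] := qpi_surj q; rewrite !qscaleE scalerA. Qed.
Fact qscale1 S : left_id 1 (@qscale S).
Proof. by move=> q; have [v ->] := qpi_surj q; rewrite !qscaleE scale1r. Qed.
Fact qscaleDr S : right_distributive (@qscale S) +%R.
Proof.
move=> a q r; have [v ->] := qpi_surj q; have [w ->] := qpi_surj r.
by rewrite -qpiD !qscaleE scalerDr qpiD.
Qed.
Fact qscaleDl S (q : quot_module S) : {morph @qscale S ^~ q : a b / a + b}.
Proof. by move=> a b; have [v ->] := qpi_surj q; rewrite !qscaleE scalerDl qpiD. Qed.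

HB.instance Definition _ S := GRing.Zmodule_isLmodule.Build k (quot_module S)
  (@qscaleA S) (@qscale1 S) (@qscaleDr S) (@qscaleDl S).

Lemma qpi_linear S : linear (qpi S).
Proof. by move=> a v w; rewrite qpiD -qscaleE. Qed.

Lemma qlift_linear S (W : lmodType k) (f : V -> W) :
  linear f -> (forall v, S v -> f v = 0) -> linear (@qlift S W f).
Proof.
move=> lf f0 a q r; have [v ->] := qpi_surj q; have [w ->] := qpi_surj r.
by rewrite -qpi_linear !qliftE // lf.
Qed.

End Span.

Section Free.
Variables (k : comPzRingType) (X : choiceType).

Definition fin_support : pred (X -> k^o) := fun F => `[< finite_set [set x | F x != 0] >].

Lemma finsupp_closed : GRing.subsemimod_closed fin_support.
Proof.
split; first split.
- by apply/asboolP; apply: (sub_finite_set _ (finite_set0 X)) => x /=; rewrite eqxx.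
- move=> F G /asboolP hF /asboolP hG; apply/asboolP.
  have := finite_setU [set x | F x != 0] [set x | G x != 0] => h.
  have hU : finite_set ([set x | F x != 0] `|` [set x | G x != 0])%classic by rewrite h.
  apply: sub_finite_set hU => x /= hx.
  have [F0|] := eqVneq (F x) 0; last by left.
  by right; move: hx; rewrite /GRing.add /= F0 add0r.
- move=> a F /asboolP hF; apply/asboolP; apply: sub_finite_set hF => x /=.
  by apply: contra_neq => F0; rewrite /GRing.scale /= F0 scaler0.
Qed.

HB.instance Definition _ := GRing.isSubmodClosed.Build k (X -> k^o) fin_support finsupp_closed.

Record free_module := Free { free_val : X -> k^o; _ : free_val \in fin_support }.

HB.instance Definition _ := [isSub for free_val].
HB.instance Definition _ := [Choice of free_module by <:].
HB.instance Definition _ := [SubChoice_isSubLmodule of free_module by <:].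

Lemma fgen_finsupp (x : X) : (fun y => (y == x)%:R : k^o) \in fin_support.
Proof.
apply/asboolP; apply: (sub_finite_set _ (finite_set1 x)) => y /=.
by case: (y =P x) => //; rewrite eqxx.
Qed.

Definition fcoef (F : free_module) (x : X) : k := free_val F x.
Arguments fcoef : simpl never.

Definition fgen (x : X) : free_module := Free (fgen_finsupp x).

Lemma coef_gen x y : fcoef (fgen x) y = (y == x)%:R.
Proof. by []. Qed.

Definition flift (W : lmodType k) (g : X -> W) (F : free_module) : W :=
  \sum_(x \in [set: X]) fcoef F x *: g x.


Lemma fliftE (W : lmodType k) (g : X -> W) (F : free_module) (r : seq X) : uniq r ->
  (forall x, fcoef F x != 0 -> x \in r) ->
  flift g F = \sum_(x <- r) fcoef F x *: g x.
Proof.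
move=> ur hr.
have hin x : x \notin r -> fcoef F x = 0.
  by apply: contraNeq => /hr.
rewrite /flift [RHS]fsbig_seq //; apply: esym.
apply: (fsbig_widen [set` r]%classic setT) => //=.
by move=> x /= [_ /negP /hin ->]; rewrite scale0r.
Qed.

Lemma free_supp (F : free_module) : exists r : seq X,
  uniq r /\ (forall x, fcoef F x != 0 -> x \in r).
Proof.
case: F => F hF; have /asboolP /finite_seqP[r hr] := hF.
exists (undup r); split => [|x Fx]; first exact: undup_uniq.
by rewrite mem_undup; have : [set x | F x != 0]%classic x by []; rewrite hr.
Qed.

Lemma flift_linear (W : lmodType k) (g : X -> W) : linear (flift g).
Proof.
move=> a F G; have [r [_ hr]] := free_supp F; have [s [_ hs]] := free_supp G.
have ut := undup_uniq (r ++ s); set t := undup _ in ut.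
have tF x : fcoef F x != 0 -> x \in t.
  by move/hr; rewrite mem_undup mem_cat => ->.
have tG x : fcoef G x != 0 -> x \in t.
  by move/hs; rewrite mem_undup mem_cat orbC => ->.
have valE x : fcoef (a *: F + G) x = a * fcoef F x + fcoef G x by [].
have tH x : fcoef (a *: F + G) x != 0 -> x \in t.
  move=> h; have [F0|/tF//] := eqVneq (fcoef F x) 0.
  by apply: tG; move: h; rewrite valE F0 mulr0 add0r.
rewrite !(fliftE g ut) // scaler_sumr -big_split /=; apply: eq_bigr => x _.
by rewrite valE scalerDl scalerA.
Qed.

Lemma flift_gen (W : lmodType k) (g : X -> W) x : flift g (fgen x) = g x.
Proof.
rewrite (@fliftE _ g (fgen x) [:: x]) // ?big_seq1 ?coef_gen ?eqxx ?scale1r //.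
by move=> y; rewrite inE coef_gen; case: (y == x) => //; rewrite eqxx.
Qed.

Lemma free_ind (P : free_module -> Prop) : P 0 ->
  (forall a x F, P F -> P (a *: fgen x + F)) -> forall F, P F.
Proof.
move=> P0 PD F; have [r [ur hr]] := free_supp F.
suff -> : F = \sum_(x <- r) fcoef F x *: fgen x.
  by elim: {ur hr} r => [|x r IH]; rewrite ?big_nil // big_cons; apply: PD.
have valS s y : fcoef (\sum_(x <- s) fcoef F x *: fgen x) y =
    \sum_(x <- s) fcoef F x * (y == x)%:R.
  elim: s => [|x s IH]; first by rewrite !big_nil.
  by rewrite !big_cons -IH.
apply: val_inj; apply/funext => y; rewrite -[LHS]/(fcoef F y) -[RHS]/(fcoef _ y) valS.
have [yr|yr] := boolP (y \in r).
  rewrite (bigD1_seq y) //= eqxx mulr1 big1 ?addr0 // => x.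
  by rewrite eq_sym => /negPf ->; rewrite mulr0.
rewrite big_seq big1 => [|x xr].
  by apply/eqP; apply: contraNT yr => /hr.
by case: (y =P x) => [yx|]; [move: yr; rewrite yx xr|rewrite mulr0].
Qed.

Lemma flift_lincomb (W : lmodType k) a (g h : X -> W) F :
  flift (fun x => a *: g x + h x) F = a *: flift g F + flift h F.
Proof.
elim/free_ind: F => [|b x F IH].
  have z f : flift f 0 = 0 :> W.
    by have := @flift_linear W f (-1) 0 0; rewrite scaler0 addr0 scaleN1r addNr.
  by rewrite !z scaler0 addr0.
rewrite !flift_linear !flift_gen IH !scalerDr !scalerA (mulrC b a).
by rewrite -!addrA; congr (_ + _); rewrite addrCA.
Qed.

End Free.

Definition bilinear_map (k : comPzRingType) (M N P : lmodType k) (f : M -> N -> P) : Prop :=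
  (forall n, linear (f ^~ n)) /\ (forall m, linear (f m)).

Section Tensor.
Variables (k : comPzRingType) (M N : lmodType k).

Inductive tensor_rel : free_module k (M * N)%type -> Prop :=
| tensor_rel_l a m m' n :
    tensor_rel (fgen k (a *: m + m', n) - (a *: fgen k (m, n) + fgen k (m', n)))
| tensor_rel_r a m n n' :
    tensor_rel (fgen k (m, a *: n + n') - (a *: fgen k (m, n) + fgen k (m, n'))).

Definition tensor : Type := quot_module tensor_rel.

HB.instance Definition _ := GRing.Lmodule.on tensor.

Definition tens (m : M) (n : N) : tensor := qpi tensor_rel (fgen k (m, n)).

Definition tlift (P : lmodType k) (f : M -> N -> P) : tensor -> P :=
  qlift (flift (fun x : M * N => f x.1 x.2)).

Local Notation "m ⊗ n" := (tens m n).

Lemma tens_bilinear : bilinear_map tens.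
Proof.
split => [n a m m'|m a n n']; rewrite /tens -qpi_linear; apply/qpiP.
  exact/span_gen/tensor_rel_l.
exact/span_gen/tensor_rel_r.
Qed.

Lemma tensZDl a m m' n : (a *: m + m') ⊗ n = a *: (m ⊗ n) + m' ⊗ n.
Proof. exact: tens_bilinear.1. Qed.

Lemma tensZDr a m n n' : m ⊗ (a *: n + n') = a *: (m ⊗ n) + m ⊗ n'.
Proof. exact: tens_bilinear.2. Qed.

Lemma tensor_ind (P : tensor -> Prop) : P 0 ->
  (forall a m n t, P t -> P (a *: (m ⊗ n) + t)) -> forall t, P t.
Proof.
move=> P0 PD t; have [F ->] := qpi_surj t.
elim/free_ind: F => [|a [m n] F IH]; last by rewrite qpi_linear; exact: PD.
suff -> : qpi tensor_rel 0 = 0 by [].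
have := qpi_linear tensor_rel (-1) 0 0.
by rewrite scaler0 addr0 scaleN1r addNr.
Qed.

Section Lift.
Variables (P : lmodType k) (f : M -> N -> P).
Hypothesis bf : bilinear_map f.

Lemma tlift_rel v : tensor_rel v -> flift (fun x : M * N => f x.1 x.2) v = 0.
Proof.
set g := (fun x : M * N => _).
have fB F G : flift g (F - G) = flift g F - flift g G.
  by have := @flift_linear k _ P g (-1) G F; rewrite !scaleN1r => h; rewrite [F - G]addrC h addrC.
by case=> [a m m' n|a m n n']; rewrite fB flift_linear !flift_gen /g /=;
  rewrite ?bf.1 ?bf.2 subrr.
Qed.

Lemma tlift_linear : linear (tlift f).
Proof. by apply: qlift_linear; [exact: flift_linear|exact: tlift_rel]. Qed.

Lemma tliftE m n : tlift f (m ⊗ n) = f m n.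
Proof.
rewrite /tlift /tens qliftE; last exact: tlift_rel; first exact: flift_gen.
exact: flift_linear.
Qed.

End Lift.

Lemma tlift_lincomb (P : lmodType k) a (f g : M -> N -> P) t :
  tlift (fun m n => a *: f m n + g m n) t = a *: tlift f t + tlift g t.
Proof. exact: flift_lincomb. Qed.

Lemma eq_tlift (P : lmodType k) (f g : M -> N -> P) t :
  (forall m n, f m n = g m n) -> tlift f t = tlift g t.
Proof. by move=> fg; have -> : f = g by apply/funext => m; apply/funext => n. Qed.

Lemma tensor_ext (P : lmodType k) (f g : tensor -> P) : linear f -> linear g ->
  (forall m n, f (m ⊗ n) = g (m ⊗ n)) -> forall t, f t = g t.
Proof.
move=> lf lg fg; elim/tensor_ind => [|a m n t IH]; last by rewrite lf lg fg IH.
have := lf (-1) 0 0; rewrite scaler0 addr0 scaleN1r addNr => ->.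
by have := lg (-1) 0 0; rewrite scaler0 addr0 scaleN1r addNr => ->.
Qed.

End Tensor.

Notation "m ⊗ n" := (tens m n) : ring_scope.

Definition tmap (k : comPzRingType) (M M' N N' : lmodType k)
    (f : M -> M') (g : N -> N') : tensor M N -> tensor M' N' :=
  tlift (fun m n => f m ⊗ g n).

Lemma tmap_bilinear (k : comPzRingType) (M M' N N' : lmodType k)
    (f : M -> M') (g : N -> N') :
  linear f -> linear g -> bilinear_map (fun m n => f m ⊗ g n).
Proof.
move=> lf lg; split => [n a m m'|m a n n'] /=; first by rewrite lf tensZDl.
by rewrite lg tensZDr.
Qed.

Definition exact_at (M N P : zmodType) (f : M -> N) (g : N -> P) : Prop :=
  forall n, g n = 0 <-> exists m, n = f m.

Definition faithfully_flat (k : comPzRingType) (V : lmodType k) : Prop :=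
  forall (M N P : lmodType k) (f : {linear M -> N}) (g : {linear N -> P}),
    exact_at f g <-> exact_at (tmap f (@id V)) (tmap g (@id V)).

HB.mixin Record Lmodule_isNAAlgebra (k : comPzRingType) A of GRing.Lmodule k A := {
  amul : A -> A -> A;
  amul_linl : forall b, linear (amul ^~ b);
  amul_linr : forall a, linear (amul a)
}.

#[short(type="naAlgType")]
HB.structure Definition NAAlgebra (k : comPzRingType) :=
  {A of Lmodule_isNAAlgebra k A & GRing.Lmodule k A}.

Notation "a ** b" := (amul a b) : ring_scope.

(* Jordan algebras are unital; k is meant to contain 1/2. *)
HB.mixin Record NAAlgebra_isJordan (k : comPzRingType) J of NAAlgebra k J := {
  jone : J;
  jmulC : forall a b : J, a ** b = b ** a;
  jmul1 : forall a : J, jone ** a = a;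
  jordan : forall a b : J, (a ** a) ** (b ** a) = ((a ** a) ** b) ** a
}.

#[short(type="jordanAlgType")]
HB.structure Definition JordanAlgebra (k : comPzRingType) :=
  {J of NAAlgebra_isJordan k J & NAAlgebra k J}.

HB.mixin Record NAAlgebra_isLie (k : comPzRingType) L of NAAlgebra k L := {
  lie_alt : forall x : L, x ** x = 0;
  lie_jacobi : forall x y z : L, x ** (y ** z) + y ** (z ** x) + z ** (x ** y) = 0
}.

#[short(type="lieAlgType")]
HB.structure Definition LieAlgebra (k : comPzRingType) :=
  {L of NAAlgebra_isLie k L & NAAlgebra k L}.

Definition alg_isomorphism (k : comPzRingType) (A B : naAlgType k) (f : A -> B) : Prop :=
  [/\ linear f, {morph f : x y / x ** y} & bijective f].

(* V viewed as a k-module through phi. *)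
Definition res_scalars (k K : comPzRingType) (phi : {rmorphism k -> K}) (V : lmodType K) : Type := V.

Section Restrict.
Variables (k K : comPzRingType) (phi : {rmorphism k -> K}) (V : lmodType K).

HB.instance Definition _ := GRing.Zmodule.on (res_scalars phi V).

Definition res_scale (a : k) (v : res_scalars phi V) : res_scalars phi V := phi a *: (v : V).

Fact res_scaleA a b v : res_scale a (res_scale b v) = res_scale (a * b) v.
Proof. by rewrite /res_scale scalerA rmorphM. Qed.
Fact res_scale1 : left_id 1 res_scale.
Proof. by move=> v; rewrite /res_scale rmorph1 scale1r. Qed.
Fact res_scaleDr : right_distributive res_scale +%R.
Proof. by move=> a v w; rewrite /res_scale scalerDr. Qed.
Fact res_scaleDl v : {morph res_scale^~ v : a b / a + b}.
Proof. by move=> a b; rewrite /res_scale rmorphD scalerDl. Qed.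

HB.instance Definition _ := GRing.Zmodule_isLmodule.Build k (res_scalars phi V)
  res_scaleA res_scale1 res_scaleDr res_scaleDl.

End Restrict.

Definition base_change (k K : comPzRingType) (phi : {rmorphism k -> K}) (V : lmodType k) : Type :=
  tensor V (res_scalars phi K^o).

Section BaseChange.
Variables (k K : comPzRingType) (phi : {rmorphism k -> K}).
Local Notation Kk := (res_scalars phi K^o).

Section Module.
Variable V : lmodType k.
Local Notation VK := (base_change phi V).
Local Notation T := (tensor V Kk).

HB.instance Definition _ := GRing.Zmodule.on VK.

Definition bc_scale (c : K) (t : VK) : VK := tlift (fun (v : V) (r : Kk) => v ⊗ (c * r : Kk)) t.

Lemma bc_bilin (c : K) : bilinear_map (fun (v : V) (r : Kk) => v ⊗ (c * r : Kk)).
Proof.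
split => [n a m m'|m a n n'] /=; first by rewrite tensZDl.
rewrite -tensZDr; congr (_ ⊗ _).
by rewrite /GRing.scale /= /res_scale /GRing.scale /= mulrDr mulrCA.
Qed.

Lemma bc_scale_linear c : linear (bc_scale c : T -> T).
Proof. exact/tlift_linear/bc_bilin. Qed.

Lemma bc_scaleE c (v : V) (r : Kk) : bc_scale c (v ⊗ r) = v ⊗ (c * r : Kk).
Proof. exact/tliftE/bc_bilin. Qed.

Fact bc_scaleA a b v : bc_scale a (bc_scale b v) = bc_scale (a * b) v.
Proof.
pose f : T -> T := fun t => bc_scale a (bc_scale b t).
apply: (@tensor_ext _ _ _ T f (bc_scale (a * b))).
- by move=> c x y; rewrite /f !bc_scale_linear.
- exact: bc_scale_linear.
- by move=> m n; rewrite /f !bc_scaleE mulrA.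
Qed.

Fact bc_scale1 : left_id 1 bc_scale.
Proof.
move=> v; apply: (@tensor_ext _ _ _ T (bc_scale 1) id) => //; first exact: bc_scale_linear.
by move=> m n; rewrite bc_scaleE mul1r.
Qed.

Fact bc_scaleDr : right_distributive bc_scale +%R.
Proof.
by move=> a v w; have := bc_scale_linear a 1 v w; rewrite !scale1r.
Qed.

Fact bc_scaleDl v : {morph bc_scale^~ v : a b / a + b}.
Proof.
move=> a b; pose f : T -> T := fun t => bc_scale a t + bc_scale b t.
apply: (@tensor_ext _ _ _ T (bc_scale (a + b)) f).
- exact: bc_scale_linear.
- by move=> c x y; rewrite /f !bc_scale_linear scalerDr addrACA.
- move=> m n; rewrite /f !bc_scaleE mulrDl.
  by have := tensZDr 1 m (a * n : Kk) (b * n : Kk); rewrite !scale1r.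
Qed.

HB.instance Definition _ := GRing.Zmodule_isLmodule.Build K VK
  bc_scaleA bc_scale1 bc_scaleDr bc_scaleDl.

End Module.

Section Algebra.
Variable A : naAlgType k.
Local Notation AK := (base_change phi A).
Local Notation T := (tensor A Kk).

(* The product with (a ⊗ r)(b ⊗ s) = ab ⊗ rs. *)
Definition bc_mul (x y : AK) : AK :=
  tlift (fun (b : A) (s : Kk) =>
    tlift (fun (a : A) (r : Kk) => (a ** b) ⊗ (r * s : Kk)) x : T) y.

Lemma bc_mul_bilin1 (b : A) (s : Kk) :
  bilinear_map (fun (a : A) (r : Kk) => (a ** b) ⊗ (r * s : Kk)).
Proof.
split => [n a m m'|m a n n'] /=; first by rewrite amul_linl tensZDl.
rewrite -tensZDr; congr (_ ⊗ _).
by rewrite /GRing.scale /= /res_scale /GRing.scale /= mulrDl mulrA.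
Qed.

Lemma bc_mul_bilin2 (x : T) :
  bilinear_map (fun (b : A) (s : Kk) =>
    tlift (fun (a : A) (r : Kk) => (a ** b) ⊗ (r * s : Kk)) x : T).
Proof.
split => [s c b b'|b c s s']; rewrite -[RHS]tlift_lincomb; apply: eq_tlift => a r.
  by rewrite amul_linr tensZDl.
rewrite -tensZDr; apply: (f_equal (tens _)).
by rewrite /GRing.scale /= /res_scale /GRing.scale /= mulrDr mulrCA.
Qed.

Lemma bc_mulE (a b : A) (r s : Kk) :
  bc_mul (a ⊗ r) (b ⊗ s) = (a ** b) ⊗ (r * s : Kk).
Proof.
by rewrite /bc_mul tliftE; [rewrite tliftE //; exact: bc_mul_bilin1|exact: bc_mul_bilin2].
Qed.

Lemma bc_mul_klinr (x : T) : linear (bc_mul x : T -> T).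
Proof. exact/tlift_linear/bc_mul_bilin2. Qed.

Lemma bc_mul_klinl (y : T) : linear (bc_mul ^~ y : T -> T).
Proof.
move=> a x x'; rewrite /bc_mul -[RHS]tlift_lincomb; apply: eq_tlift => b s.
exact/tlift_linear/bc_mul_bilin1.
Qed.

Lemma bc_mulZ (c : K) (x y : T) :
  bc_mul (bc_scale c x) y = bc_scale c (bc_mul x y) /\
  bc_mul x (bc_scale c y) = bc_scale c (bc_mul x y).
Proof.
pose l1 : T -> T := fun x => bc_mul (bc_scale c x) y.
pose l2 : T -> T := fun x => bc_mul x (bc_scale c y).
pose r : T -> T := fun x => bc_scale c (bc_mul x y).
have ll1 : linear l1 by move=> a u v; rewrite /l1 bc_scale_linear bc_mul_klinl.
have ll2 : linear l2 by move=> a u v; rewrite /l2 bc_mul_klinl.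
have lr : linear r by move=> a u v; rewrite /r bc_mul_klinl bc_scale_linear.
split; [apply: (tensor_ext ll1 lr)|apply: (tensor_ext ll2 lr)] => a s;
  rewrite /l1 /l2 /r ?bc_scaleE.
  pose m1 : T -> T := fun y => bc_mul (a ⊗ (c * s : Kk)) y.
  pose m2 : T -> T := fun y => bc_scale c (bc_mul (a ⊗ s) y).
  apply: (@tensor_ext _ _ _ T m1 m2).
  - by move=> b u v; rewrite /m1 bc_mul_klinr.
  - by move=> b u v; rewrite /m2 bc_mul_klinr bc_scale_linear.
  - by move=> b u; rewrite /m1 /m2 !bc_mulE bc_scaleE mulrA.
pose m1 : T -> T := fun y => bc_mul (a ⊗ s) (bc_scale c y).
pose m2 : T -> T := fun y => bc_scale c (bc_mul (a ⊗ s) y).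
apply: (@tensor_ext _ _ _ T m1 m2).
- by move=> b u v; rewrite /m1 bc_scale_linear bc_mul_klinr.
- by move=> b u v; rewrite /m2 bc_mul_klinr bc_scale_linear.
- by move=> b u; rewrite /m1 /m2 bc_scaleE !bc_mulE bc_scaleE mulrCA.
Qed.

Fact bc_mul_linl (y : AK) : linear (bc_mul ^~ y).
Proof.
move=> c x x' /=; have := bc_mul_klinl y 1 (c *: x : AK) x'.
by rewrite !scale1r => ->; congr (_ + _); exact: (bc_mulZ c x y).1.
Qed.

Fact bc_mul_linr (x : AK) : linear (bc_mul x).
Proof.
move=> c y y' /=; have := bc_mul_klinr x 1 (c *: y : AK) y'.
by rewrite !scale1r => ->; congr (_ + _); exact: (bc_mulZ c x y).2.
Qed.

HB.instance Definition _ := Lmodule_isNAAlgebra.Build K AK bc_mul_linl bc_mul_linr.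

End Algebra.
End BaseChange.

Section Octonions.
Variable K : comPzRingType.

Definition dotp (u v : 'rV[K]_3) : K := \sum_i u 0 i * v 0 i.

(* Indices are taken modulo 3. *)
Definition crossp (u v : 'rV[K]_3) : 'rV[K]_3 :=
  \row_(i < 3) (u 0 (i + 1) * v 0 (i + 2%:R) - u 0 (i + 2%:R) * v 0 (i + 1)).

(* ((a1, u), (x, a2)) stands for the matrix with rows (a1 u) and (x a2). *)
Definition octonion : Type := ((K^o * 'rV[K]_3) * ('rV[K]_3 * K^o))%type.

HB.instance Definition _ := GRing.Lmodule.on octonion.

Definition Oct (a1 : K) (u x : 'rV[K]_3) (a2 : K) : octonion := ((a1, u), (x, a2)).
Definition oa1 (z : octonion) : K := z.1.1.
Definition ou (z : octonion) : 'rV[K]_3 := z.1.2.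
Definition ox (z : octonion) : 'rV[K]_3 := z.2.1.
Definition oa2 (z : octonion) : K := z.2.2.

Definition omul (z w : octonion) : octonion :=
  Oct (oa1 z * oa1 w - dotp (ou z) (ox w))
      (oa1 z *: ou w + oa2 w *: ou z + crossp (ox z) (ox w))
      (oa1 w *: ox z + oa2 z *: ox w + crossp (ou z) (ou w))
      (oa2 z * oa2 w - dotp (ox z) (ou w)).

Definition oone : octonion := Oct 1 0 0 1.
Definition otrace (z : octonion) : K := oa1 z + oa2 z.
Definition oconj (z : octonion) : octonion := otrace z *: oone - z.

Lemma octP (z w : octonion) :
  oa1 z = oa1 w -> ou z = ou w -> ox z = ox w -> oa2 z = oa2 w -> z = w.
Proof. by case: z w => [[a u] [x b]] [[a' u'] [x' b']]; rewrite /oa1 /ou /ox /oa2 /= => -> -> -> ->. Qed.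

Lemma dotpC u v : dotp u v = dotp v u.
Proof. by apply: eq_bigr => i _; rewrite mulrC. Qed.

Lemma dotp_linr u a v w : dotp u (a *: v + w) = a * dotp u v + dotp u w.
Proof.
rewrite /dotp mulr_sumr -big_split; apply: eq_bigr => i _ /=.
by rewrite !mxE mulrDr mulrCA.
Qed.

Lemma dotp_linl u a v w : dotp (a *: v + w) u = a * dotp v u + dotp w u.
Proof. by rewrite dotpC dotp_linr !(dotpC u). Qed.

Lemma crossp_linr u a v w : crossp u (a *: v + w) = a *: crossp u v + crossp u w.
Proof. by apply/rowP => i; rewrite !mxE; ring. Qed.

Lemma crossp_linl u a v w : crossp (a *: v + w) u = a *: crossp v u + crossp w u.
Proof. by apply/rowP => i; rewrite !mxE; ring. Qed.

Lemma oa1L a z w : oa1 (a *: z + w) = a * oa1 z + oa1 w. Proof. by []. Qed.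
Lemma ouL a z w : ou (a *: z + w) = a *: ou z + ou w. Proof. by []. Qed.
Lemma oxL a z w : ox (a *: z + w) = a *: ox z + ox w. Proof. by []. Qed.
Lemma oa2L a z w : oa2 (a *: z + w) = a * oa2 z + oa2 w. Proof. by []. Qed.
Definition octL := (oa1L, ouL, oxL, oa2L).

Fact omul_linl w : linear (omul ^~ w).
Proof.
move=> a z z'; apply: octP; rewrite !octL /omul /= ?octL /oa1 /ou /ox /oa2 /=
  ?dotp_linl ?crossp_linl; first by ring.
- by apply/rowP => i; rewrite !mxE; ring.
- by apply/rowP => i; rewrite !mxE; ring.
- by ring.
Qed.

Fact omul_linr z : linear (omul z).
Proof.
move=> a w w'; apply: octP; rewrite !octL /omul /= ?octL /oa1 /ou /ox /oa2 /=
  ?dotp_linr ?crossp_linr; first by ring.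
- by apply/rowP => i; rewrite !mxE; ring.
- by apply/rowP => i; rewrite !mxE; ring.
- by ring.
Qed.

HB.instance Definition _ := Lmodule_isNAAlgebra.Build K octonion omul_linl omul_linr.

Lemma oconjE z : oconj z = Oct (oa2 z) (- ou z) (- ox z) (oa1 z).
Proof.
case: z => [[a u] [x b]]; apply: octP; rewrite /oconj /otrace /oa1 /ou /ox /oa2 /=.
- by rewrite [_ *: _]mulr1; ring.
- by apply/rowP => i; rewrite !mxE; ring.
- by apply/rowP => i; rewrite !mxE; ring.
- by rewrite [_ *: _]mulr1; ring.
Qed.

Lemma oconj_linear : linear oconj.
Proof.
move=> a z w; rewrite !oconjE; apply: octP; rewrite !octL //=.
  by rewrite /ou /= scalerN opprD.
by rewrite /ox /= scalerN opprD.
Qed.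

Lemma oconjK z : oconj (oconj z) = z.
Proof. by rewrite !oconjE; apply: octP; rewrite /ou /ox //= opprK. Qed.

Lemma dotpNN u v : dotp (- u) (- v) = dotp u v.
Proof. by apply: eq_bigr => i _; rewrite !mxE mulrNN. Qed.

Lemma oconjM z w : oconj (z ** w) = oconj w ** oconj z.
Proof.
rewrite !oconjE; apply: octP; rewrite /amul /= /omul /oa1 /ou /ox /oa2 /= ?dotpNN.
- by rewrite mulrC dotpC.
- by apply/rowP => i; rewrite !mxE; ring.
- by apply/rowP => i; rewrite !mxE; ring.
- by rewrite mulrC dotpC.
Qed.

Lemma oconj_trace z : z + oconj z = otrace z *: oone.
Proof. by rewrite /oconj addrC subrK. Qed.

End Octonions.

Definition nat_invertible (R : comPzRingType) (n : nat) : Prop := exists c : R, c * n%:R = 1.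

(* The inverse of 2 (unique if it exists, and 0 otherwise). *)
Definition inv2 (R : comPzRingType) : R := xget 0 [set c : R | c * 2%:R = 1]%classic.

Section SplitAlbert.
Variable K : comPzRingType.
Local Notation O := (octonion K).

Definition octmx : Type := 'I_3 -> 'I_3 -> O.

HB.instance Definition _ := GRing.Lmodule.on octmx.

Local Notation M3 := octmx.

Definition omxmul (A B : M3) : M3 := fun i j => \sum_l A i l ** B l j.

Definition oct_hermitian : M3 -> bool := fun A =>
  `[< (forall i j, oconj (A j i) = A i j) /\
      (forall i, exists c : K, A i i = c *: oone K) >].

Lemma hermitian_closed : GRing.subsemimod_closed oct_hermitian.
Proof.
split; first split.
- apply/asboolP; split=> [i j|i]; last by exists 0; rewrite scale0r.
  by rewrite oconjE; apply: octP; rewrite /ou /ox //= oppr0.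
- move=> A B /asboolP[hA dA] /asboolP[hB dB]; apply/asboolP; split=> [i j|i].
    have := oconj_linear 1 (A j i) (B j i); rewrite !scale1r => h.
    by rewrite -[LHS]/(oconj (A j i + B j i)) h hA hB.
  have [a ha] := dA i; have [b hb] := dB i; exists (a + b).
  by rewrite scalerDl -ha -hb.
- move=> a A /asboolP[hA dA]; apply/asboolP; split=> [i j|i].
    have := oconj_linear a (A j i) 0; rewrite !addr0 => h.
    rewrite -[LHS]/(oconj (a *: A j i)) h hA.
    suff -> : oconj (0 : O) = 0 by rewrite addr0.
    by rewrite oconjE; apply: octP; rewrite /ou /ox //= oppr0.
  by have [b hb] := dA i; exists (a * b); rewrite -scalerA -hb.
Qed.

HB.instance Definition _ := GRing.isSubmodClosed.Build K M3 oct_hermitian hermitian_closed.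

Record split_albert := SplitAlbert { albert_mx : M3; _ : albert_mx \in oct_hermitian }.

HB.instance Definition _ := [isSub for albert_mx].
HB.instance Definition _ := [Choice of split_albert by <:].
HB.instance Definition _ := [SubChoice_isSubLmodule of split_albert by <:].

Definition omxjordan (A B : M3) : M3 := inv2 K *: (omxmul A B + omxmul B A).

Lemma omxjordan_hermitian (A B : split_albert) :
  omxjordan (albert_mx A) (albert_mx B) \in oct_hermitian.
Proof.
case: A B => A hA' [B hB'] /=.
have /asboolP[hA _] := hA'; have /asboolP[hB _] := hB'.
apply: hermitian_closed.2; apply/asboolP.
have conj_sum (F : 'I_3 -> O) : oconj (\sum_l F l) = \sum_l oconj (F l).
  apply: (big_morph (@oconj K)) => [z w|].
    by have := oconj_linear 1 z w; rewrite !scale1r.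
  by rewrite oconjE; apply: octP; rewrite /ou /ox //= oppr0.
have conjM (C D : M3) i j :
    (forall i j, oconj (C j i) = C i j) -> (forall i j, oconj (D j i) = D i j) ->
    oconj (omxmul C D j i) = omxmul D C i j.
  move=> hC hD; rewrite /omxmul conj_sum; apply: eq_bigr => l _.
  by rewrite oconjM hC hD.
split=> [i j|i].
  rewrite -[LHS]/(oconj (omxmul A B j i + omxmul B A j i)).
  have := oconj_linear 1 (omxmul A B j i) (omxmul B A j i).
  by rewrite !scale1r => ->; rewrite !conjM // addrC.
exists (otrace (omxmul A B i i)); rewrite -oconj_trace.
by rewrite conjM.
Qed.

Definition albert_mul (A B : split_albert) : split_albert :=
  SplitAlbert (omxjordan_hermitian A B).

Lemma omxmul_linl B : linear (omxmul ^~ B).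
Proof.
move=> a A A'; apply/funext => i; apply/funext => j.
rewrite -[RHS]/(a *: (\sum_l A i l ** B l j) + \sum_l A' i l ** B l j).
rewrite scaler_sumr -big_split; apply: eq_bigr => l _ /=.
exact: amul_linl.
Qed.

Lemma omxmul_linr A : linear (omxmul A).
Proof.
move=> a B B'; apply/funext => i; apply/funext => j.
rewrite -[RHS]/(a *: (\sum_l A i l ** B l j) + \sum_l A i l ** B' l j).
rewrite scaler_sumr -big_split; apply: eq_bigr => l _ /=.
exact: amul_linr.
Qed.

Lemma lincomb_half (V : lmodType K) (h a : K) (x y z w : V) :
  h *: ((a *: x + y) + (a *: z + w)) = a *: (h *: (x + z)) + h *: (y + w).
Proof. by rewrite addrACA !scalerDr !scalerA (mulrC h a). Qed.

Fact albert_mul_linl B : linear (albert_mul ^~ B).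
Proof.
move=> a A A'; apply: val_inj; rewrite /= /omxjordan omxmul_linl omxmul_linr.
exact: lincomb_half.
Qed.

Fact albert_mul_linr A : linear (albert_mul A).
Proof.
move=> a B B'; apply: val_inj; rewrite /= /omxjordan omxmul_linl omxmul_linr.
exact: lincomb_half.
Qed.

HB.instance Definition _ :=
  Lmodule_isNAAlgebra.Build K split_albert albert_mul_linl albert_mul_linr.

End SplitAlbert.

Definition albert_algebra (k : comPzRingType) (J : jordanAlgType k) : Prop :=
  exists (K : comPzRingType) (phi : {rmorphism k -> K}),
    faithfully_flat (res_scalars phi K^o) /\
    exists f : base_change phi J -> split_albert K, alg_isomorphism f.

(* A reflexive decision procedure for identities in abelian groups. *)
Module AbelianGroup.

Inductive expr := Var of nat | Zero | Add of expr & expr | Opp of expr.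

Fixpoint eval (V : zmodType) (env : seq V) (e : expr) : V :=
  match e with
  | Var i => nth 0 env i
  | Zero => 0
  | Add a b => eval env a + eval env b
  | Opp a => - eval env a
  end.

Fixpoint coefs (i : nat) (e : expr) : int :=
  match e with
  | Var j => (i == j)%:R
  | Zero => 0
  | Add a b => coefs i a + coefs i b
  | Opp a => - coefs i a
  end.

Fixpoint bounded (n : nat) (e : expr) : bool :=
  match e with
  | Var j => (j < n)%N
  | Zero => true
  | Add a b => bounded n a && bounded n b
  | Opp a => bounded n a
  end.

Lemma evalE (V : zmodType) (env : seq V) e : bounded (size env) e ->
  eval env e = \sum_(i < size env) env`_i *~ coefs i e.
Proof.
elim: e => [j|a|a IHa b IHb|a IHa] /=.
- move=> jn; rewrite (bigD1 (Ordinal jn)) //= eqxx mulr1z big1 ?addr0 // => i.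
  by rewrite -val_eqE /= => /negPf ->; rewrite mulr0z.
- by rewrite big1 // => i _; rewrite mulr0z.
- case/andP=> /IHa -> /IHb ->; rewrite -big_split; apply: eq_bigr => i _.
  by rewrite mulrzDr.
- by move=> /IHa ->; rewrite -sumrN; apply: eq_bigr => i _; rewrite mulrNz.
Qed.

Definition check (n : nat) (e f : expr) : bool :=
  [&& bounded n e, bounded n f & all (fun i => coefs i e == coefs i f) (iota 0 n)].

Lemma checkP (V : zmodType) (env : seq V) e f :
  check (size env) e f -> eval env e = eval env f.
Proof.
case/and3P=> be bf /allP h; rewrite !evalE //; apply: eq_bigr => i _.
by rewrite (eqP (h i _)) // mem_iota /= add0n.
Qed.

Ltac index x env :=
  lazymatch env with
  | ?y :: ?t =>
      match goal with
      | _ => let _ := match goal with _ => unify x y end in constr:(0%N)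
      | _ => let n := index x t in constr:(S n)
      end
  end.

Ltac insert x env :=
  match goal with
  | _ => let _ := index x env in constr:(env)
  | _ => constr:(x :: env)
  end.

Ltac collect t env :=
  lazymatch t with
  | @Algebra.add _ ?a ?b => let env := collect a env in collect b env
  | @Algebra.opp _ ?a => collect a env
  | @Algebra.zero _ => env
  | _ => insert t env
  end.

Ltac reify t env :=
  lazymatch t with
  | @Algebra.add _ ?a ?b =>
      let a := reify a env in let b := reify b env in constr:(Add a b)
  | @Algebra.opp _ ?a => let a := reify a env in constr:(Opp a)
  | @Algebra.zero _ => constr:(Zero)
  | _ => let i := index t env in constr:(Var i)
  end.

Ltac solve_in V :=
  lazymatch goal with
  | |- ?a = ?b =>
      let env := collect a (@nil (Algebra.Zmodule.sort V)) in
      let env := collect b env in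
      let e := reify a env in let f := reify b env in
      exact (@checkP V env e f isT)
  end.

End AbelianGroup.

Section NAAlgebraTheory.
Variables (k : comPzRingType) (A : naAlgType k).
Implicit Types a b c : A.

Lemma amulDl a b c : (a + b) ** c = a ** c + b ** c.
Proof. by have := amul_linl c 1 a b; rewrite /= !scale1r. Qed.
Lemma amulDr a b c : a ** (b + c) = a ** b + a ** c.
Proof. by have := amul_linr a 1 b c; rewrite !scale1r. Qed.
Lemma amul0l c : 0 ** c = 0 :> A.
Proof. by have := amul_linl c (-1) 0 0; rewrite /= scaler0 addr0 scaleN1r addNr. Qed.
Lemma amul0r c : c ** 0 = 0 :> A.
Proof. by have := amul_linr c (-1) 0 0; rewrite /= scaler0 addr0 scaleN1r addNr. Qed.
Lemma amulZl s a c : (s *: a) ** c = s *: (a ** c).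
Proof. by have := amul_linl c s a 0; rewrite /= amul0l !addr0. Qed.
Lemma amulZr s a c : a ** (s *: c) = s *: (a ** c).
Proof. by have := amul_linr a s c 0; rewrite /= amul0r !addr0. Qed.
Lemma amulNl a c : (- a) ** c = - (a ** c).
Proof. by rewrite -scaleN1r amulZl scaleN1r. Qed.
Lemma amulNr a c : a ** (- c) = - (a ** c).
Proof. by rewrite -scaleN1r amulZr scaleN1r. Qed.
End NAAlgebraTheory.

Definition amulE := (amulDl, amulDr, amulNl, amulNr).

Lemma double_inj (k : comPzRingType) (V : lmodType k) (v : V) :
  nat_invertible k 2 -> v + v = 0 -> v = 0.
Proof.
case=> c hc hv; rewrite -[v]scale1r -hc -scalerA.
by rewrite scaler_nat mulr2n hv scaler0.
Qed.

Lemma amulC (k : comPzRingType) (J : jordanAlgType k) (a b : J) : a ** b = b ** a.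
Proof. exact: jmulC. Qed.

Section JordanTheory.
Variables (k : comPzRingType) (J : jordanAlgType k).
Hypothesis h2 : nat_invertible k 2.
Implicit Types a b c u v w x y z : J.

Local Ltac zmod := AbelianGroup.solve_in J.

Let B b p q r : J := (p ** q) ** (b ** r) - ((p ** q) ** b) ** r.

Let BC b p q r : B b p q r = B b q p r.
Proof. by rewrite /B (amulC p q). Qed.
Let Bxxx b x : B b x x x = 0.
Proof. by rewrite /B jordan subrr. Qed.
Let BD1 b p p' q r : B b (p + p') q r = B b p q r + B b p' q r.
Proof. by rewrite /B !amulE; zmod. Qed.
Let BD2 b p q q' r : B b p (q + q') r = B b p q r + B b p q' r.
Proof. by rewrite /B !amulE; zmod. Qed.
Let BD3 b p q r r' : B b p q (r + r') = B b p q r + B b p q r'.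
Proof. by rewrite /B !amulE; zmod. Qed.
Let BN1 b p q r : B b (- p) q r = - B b p q r.
Proof. by rewrite /B !amulE; zmod. Qed.
Let BN2 b p q r : B b p (- q) r = - B b p q r.
Proof. by rewrite /B !amulE; zmod. Qed.
Let BN3 b p q r : B b p q (- r) = - B b p q r.
Proof. by rewrite /B !amulE; zmod. Qed.

Let q1 b x z : J := B b x x z + B b x z x + B b z x x.

Let q1_0 b x z : q1 b x z = 0.
Proof.
have e1 : B b (x + z) (x + z) (x + z) = 0 := Bxxx b _.
have e2 : B b (x + - z) (x + - z) (x + - z) = 0 := Bxxx b _.
apply: (double_inj h2).
have -> : q1 b x z + q1 b x z = B b (x + z) (x + z) (x + z)
    - B b (x + - z) (x + - z) (x + - z) - B b z z z - B b z z z.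
  by rewrite /q1 !BD1 !BD2 !BD3 !BN1 !BN2 !BN3; zmod.
by rewrite e1 e2 Bxxx !subr0.
Qed.

Let B_lin b x w z : B b x w z + B b x z w + B b w z x = 0.
Proof.
apply: (double_inj h2).
have -> : B b x w z + B b x z w + B b w z x + (B b x w z + B b x z w + B b w z x) =
  q1 b (x + w) z - q1 b x z - q1 b w z.
  by rewrite /q1 !BD1 !BD2 !BD3 !(BC b w x) !(BC b z x) !(BC b z w); zmod.
by rewrite !q1_0 !subr0.
Qed.

Lemma jordan_lin b x w z :
  (x ** w) ** (b ** z) + (x ** z) ** (b ** w) + (w ** z) ** (b ** x) =
  ((x ** w) ** b) ** z + ((x ** z) ** b) ** w + ((w ** z) ** b) ** x.
Proof.
apply/eqP; rewrite -subr_eq0 -(B_lin b x w z) /B; apply/eqP; zmod.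
Qed.

(* [L_(xw), L_z] + [L_(xz), L_w] + [L_(wz), L_x] = 0 *)
Lemma jordan_cyc b x w z :
  (x ** w) ** (z ** b) + (x ** z) ** (w ** b) + (w ** z) ** (x ** b) =
  z ** ((x ** w) ** b) + w ** ((x ** z) ** b) + x ** ((w ** z) ** b).
Proof.
rewrite (amulC z b) (amulC w b) (amulC x b) jordan_lin.
by rewrite (amulC z (_ ** b)) (amulC w (_ ** b)) (amulC x (_ ** b)).
Qed.

Definition jder y z a : J := y ** (z ** a) - z ** (y ** a).

Lemma jder_mul y z x w : jder y z (x ** w) = jder y z x ** w + x ** jder y z w.
Proof.
have e : ((x ** w) ** y) ** z + ((x ** z) ** y) ** w + ((w ** z) ** y) ** x =
         ((x ** w) ** z) ** y + ((x ** y) ** z) ** w + ((w ** y) ** z) ** x.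
  rewrite -!jordan_lin (amulC y z) (amulC y w) (amulC y x) (amulC z w) (amulC z x).
  rewrite (amulC (x ** y)) (amulC (w ** y)); zmod.
have e' : z ** (y ** (x ** w)) + (y ** (z ** x)) ** w + x ** (y ** (z ** w)) =
          y ** (z ** (x ** w)) + (z ** (y ** x)) ** w + x ** (z ** (y ** w)).
  rewrite (amulC z (_ ** _)) (amulC y (x ** w)) (amulC y (z ** x)) (amulC z x).
  rewrite (amulC x (y ** _)) (amulC y (z ** w)) (amulC z w) e.
  rewrite (amulC y (z ** _)) (amulC z (x ** w)) (amulC z (y ** x)) (amulC y x).
  by rewrite (amulC x (z ** _)) (amulC z (y ** w)) (amulC y w).
rewrite /jder !amulE; apply/eqP; rewrite -subr_eq0.
move/eqP: e'; rewrite -subr_eq0 => /eqP e'; rewrite -oppr_eq0 -e'; apply/eqP; zmod.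
Qed.

Definition jv a b c : J := jder a b c + (a ** b) ** c.

Lemma jder_jv y z u v w :
  jder y z (jv u v w) = jv (jder y z u) v w + jv u (jder y z v) w + jv u v (jder y z w).
Proof.
have dD a b : jder y z (a + b) = jder y z a + jder y z b.
  by rewrite /jder !amulE; zmod.
have dN a : jder y z (- a) = - jder y z a.
  by rewrite /jder !amulE; zmod.
have dM := jder_mul y z; move: (jder y z) dD dN dM => d dD dN dM.
rewrite /jv /jder !(dD, dN, dM) !amulE; zmod.
Qed.

Lemma amul_jv a x y z :
  a ** jv x y z = jv (a ** x) y z - jv x (a ** y) z + jv x y (a ** z).
Proof.
have e1 : jder x y (a ** z) = jder x y a ** z + a ** jder x y z by exact: jder_mul.
have e2 : jder (a ** x) y z - jder x (a ** y) z = a ** ((x ** y) ** z) - (x ** y) ** (a ** z).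
  have := jordan_cyc z a x y => /eqP; rewrite -subr_eq0 => /eqP e.
  apply/eqP; rewrite -subr_eq0 -e /jder; apply/eqP; zmod.
rewrite /jv e1.
have -> : jder (a ** x) y z + a ** x ** y ** z - (jder x (a ** y) z + x ** (a ** y) ** z) =
  (jder (a ** x) y z - jder x (a ** y) z) + (a ** x ** y ** z - x ** (a ** y) ** z) by zmod.
rewrite e2 {2}/jder !amulE (amulC (a ** x) y) (amulC a x) (amulC a y); zmod.
Qed.

Lemma jv_jv u v x y z :
  jv u v (jv x y z) = jv (jv u v x) y z - jv x (jv v u y) z + jv x y (jv u v z).
Proof.
rewrite {1}/jv jder_jv amul_jv.
have jvD1 a b c d : jv (a + b) c d = jv a c d + jv b c d.
  by rewrite /jv /jder !amulE; zmod.
have jvD2 a b c d : jv a (b + c) d = jv a b d + jv a c d.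
  by rewrite /jv /jder !amulE; zmod.
have jvD3 a b c d : jv a b (c + d) = jv a b c + jv a b d.
  by rewrite /jv /jder !amulE; zmod.
have jvN2 a b c : jv a (- b) c = - jv a b c.
  by rewrite /jv /jder !amulE; zmod.
have e w : jv u v w = jder u v w + (u ** v) ** w by [].
have e' w : jv v u w = - jder u v w + (u ** v) ** w.
  by rewrite /jv /jder (amulC v u); zmod.
rewrite !e e'; move: (jder u v) => d; rewrite !(jvD1, jvD2, jvD3, jvN2); zmod.
Qed.

End JordanTheory.

Section TKK.
Variables (k : comPzRingType) (J : jordanAlgType k).
Implicit Types a b c u v w x y z : J.

Definition jtriple x y z : J := (x ** (y ** z) + z ** (y ** x) - y ** (z ** x)) *+ 2.

Local Ltac zmod := AbelianGroup.solve_in J.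

Lemma jtripleE x y z : jtriple x y z = jv x y z + jv x y z.
Proof.
rewrite /jtriple mulr2n /jv /jder.
rewrite [z ** (y ** x)]amulC [y ** x]amulC [z ** x]amulC; zmod.
Qed.

Lemma jtripleC x y z : jtriple x y z = jtriple z y x.
Proof. by rewrite /jtriple (amulC z x) [X in X - _]addrC. Qed.

Lemma jtriple_lin1 y z : linear (fun x => jtriple x y z).
Proof.
move=> a x x'; rewrite /jtriple !(amulDl, amulDr, amulZl, amulZr) !mulr2n.
by rewrite !(scalerDr, scalerN); zmod.
Qed.

Lemma jtriple_lin2 x z : linear (fun y => jtriple x y z).
Proof.
move=> a y y'; rewrite /jtriple !(amulDl, amulDr, amulZl, amulZr) !mulr2n.
by rewrite !(scalerDr, scalerN); zmod.
Qed.

Lemma jtriple_lin3 x y : linear (jtriple x y).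
Proof.
move=> a z z'; rewrite /jtriple !(amulDl, amulDr, amulZl, amulZr) !mulr2n.
by rewrite !(scalerDr, scalerN); zmod.
Qed.

Definition jend : Type := ((J -> J) * (J -> J))%type.

HB.instance Definition _ := GRing.Lmodule.on jend.

Definition delta x y : jend := (fun z => jtriple x y z, fun w => - jtriple y x w).

Definition jcomm (S T : jend) : jend :=
  (fun z => S.1 (T.1 z) - T.1 (S.1 z), fun w => S.2 (T.2 w) - T.2 (S.2 w)).

Inductive ider_gen : jend -> Prop := Ider_gen x y : ider_gen (delta x y).

Record ider := Ider { ider_val : jend; _ : ider_val \in in_span ider_gen }.

HB.instance Definition _ := [isSub for ider_val].
HB.instance Definition _ := [Choice of ider by <:].
HB.instance Definition _ := [SubChoice_isSubLmodule of ider by <:].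

Lemma deltaP x y : delta x y \in in_span ider_gen.
Proof. exact/asboolP/span_gen/Ider_gen. Qed.

Definition ider_delta x y : ider := Ider (deltaP x y).

Lemma delta_lin1 y : linear (delta ^~ y).
Proof.
move=> a x x'; apply: (f_equal2 pair); apply/funext => z; first exact: jtriple_lin1.
rewrite jtriple_lin2 opprD.
by rewrite -[RHS]/(a *: (- jtriple y x z) + - jtriple y x' z) scalerN.
Qed.

Lemma delta_lin2 x : linear (delta x).
Proof.
move=> a y y'; apply: (f_equal2 pair); apply/funext => z; first exact: jtriple_lin2.
rewrite jtriple_lin1 opprD.
by rewrite -[RHS]/(a *: (- jtriple y x z) + - jtriple y' x z) scalerN.
Qed.

Lemma ider_delta_lin1 y : linear (ider_delta ^~ y).
Proof. by move=> a x x'; apply: val_inj; exact: delta_lin1. Qed.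

Lemma ider_delta_lin2 x : linear (ider_delta x).
Proof. by move=> a y y'; apply: val_inj; exact: delta_lin2. Qed.

Lemma span_linear (T : jend) : lin_span ider_gen T -> linear T.1 /\ linear T.2.
Proof.
elim=> [|a _ T' [x y] _ [IH1 IH2]].
  by split=> a u v; rewrite -[LHS]/(0 : J) -[RHS]/(a *: (0 : J) + 0) scaler0 addr0.
split=> b u v.
- rewrite -[LHS]/(a *: jtriple x y (b *: u + v) + T'.1 (b *: u + v)).
  rewrite -[RHS]/(b *: (a *: jtriple x y u + T'.1 u) + (a *: jtriple x y v + T'.1 v)).
  by rewrite jtriple_lin3 IH1 !scalerDr !scalerA (mulrC b); zmod.
- rewrite -[LHS]/(a *: (- jtriple y x (b *: u + v)) + T'.2 (b *: u + v)).
  rewrite -[RHS]/(b *: (a *: (- jtriple y x u) + T'.2 u) + (a *: (- jtriple y x v) + T'.2 v)).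
  by rewrite jtriple_lin3 IH2 opprD -!scalerN !scalerDr !scalerA (mulrC b) !scalerN; zmod.
Qed.

Lemma jcomm_lin1 (a : k) (S S' T : jend) : linear T.1 -> linear T.2 ->
  jcomm (a *: S + S') T = a *: jcomm S T + jcomm S' T.
Proof.
move=> lT1 lT2; apply: (f_equal2 pair); apply/funext => z.
- rewrite -[LHS]/(a *: S.1 (T.1 z) + S'.1 (T.1 z) - T.1 (a *: S.1 z + S'.1 z)).
  rewrite -[RHS]/(a *: (S.1 (T.1 z) - T.1 (S.1 z)) + (S'.1 (T.1 z) - T.1 (S'.1 z))).
  by rewrite lT1 !(scalerDr, scalerN); zmod.
- rewrite -[LHS]/(a *: S.2 (T.2 z) + S'.2 (T.2 z) - T.2 (a *: S.2 z + S'.2 z)).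
  rewrite -[RHS]/(a *: (S.2 (T.2 z) - T.2 (S.2 z)) + (S'.2 (T.2 z) - T.2 (S'.2 z))).
  by rewrite lT2 !(scalerDr, scalerN); zmod.
Qed.

Lemma jcommC S T : jcomm S T = - jcomm T S.
Proof.
apply: (f_equal2 pair); apply/funext => z.
  by rewrite -[RHS]/(- (T.1 (S.1 z) - S.1 (T.1 z))) opprB.
by rewrite -[RHS]/(- (T.2 (S.2 z) - S.2 (T.2 z))) opprB.
Qed.

Lemma jcomm_lin2 (a : k) (S T T' : jend) : linear S.1 -> linear S.2 ->
  jcomm S (a *: T + T') = a *: jcomm S T + jcomm S T'.
Proof.
move=> lS1 lS2; rewrite jcommC jcomm_lin1 // (jcommC S T) (jcommC S T').
by rewrite opprD scalerN.
Qed.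

Section Half.
Hypothesis h2 : nat_invertible k 2.

(* The defining identity of Jordan pairs. *)
Lemma jtriple_pair u v x y z :
  jtriple u v (jtriple x y z) - jtriple x y (jtriple u v z) =
  jtriple (jtriple u v x) y z - jtriple x (jtriple v u y) z.
Proof.
have D3 a b c d : jtriple a b (c + d) = jtriple a b c + jtriple a b d.
  by have := jtriple_lin3 a b 1 c d; rewrite !scale1r.
have D2 a b c d : jtriple a (b + c) d = jtriple a b d + jtriple a c d.
  by have := jtriple_lin2 a d 1 b c; rewrite !scale1r.
have D1 a b c d : jtriple (a + b) c d = jtriple a c d + jtriple b c d.
  by have := jtriple_lin1 c d 1 a b; rewrite !scale1r.
rewrite (jtripleE x y z) (jtripleE u v z) (jtripleE u v x) (jtripleE v u y).
rewrite (D1 (jv u v x)) (D2 _ (jv v u y)) (D3 _ _ (jv x y z)) (D3 _ _ (jv u v z)).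
by rewrite !jtripleE (jv_jv h2 u v x y z); zmod.
Qed.

Lemma jcomm_delta (S : jend) x y : lin_span ider_gen S ->
  jcomm S (delta x y) = delta (S.1 x) y + delta x (S.2 y).
Proof.
elim=> [|a _ T [u v] hT IH].
  have z1 : delta 0 y = 0 by have := delta_lin1 y (-1) 0 0; rewrite /= scaler0 addr0 scaleN1r addNr.
  have z2 : delta x 0 = 0 by have := delta_lin2 x (-1) 0 0; rewrite /= scaler0 addr0 scaleN1r addNr.
  rewrite -[X in _ = delta X y + _]/(0 : J) -[X in _ = _ + delta x X]/(0 : J) z1 z2 addr0.
  apply: (f_equal2 pair); apply/funext => z.
    have z3 : jtriple x y 0 = 0.
      by have := jtriple_lin3 x y (-1) 0 0; rewrite scaler0 addr0 scaleN1r addNr.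
    by rewrite -[LHS]/(0 - jtriple x y 0) z3 subrr.
  have z3 : jtriple y x 0 = 0.
    by have := jtriple_lin3 y x (-1) 0 0; rewrite scaler0 addr0 scaleN1r addNr.
  by rewrite -[LHS]/(0 - - jtriple y x 0) z3 oppr0 subrr.
have [l1 l2] : linear (delta x y).1 /\ linear (delta x y).2.
  by apply/span_linear/span_gen/Ider_gen.
rewrite jcomm_lin1 // IH.
rewrite -[X in _ = delta X y + _]/(a *: jtriple u v x + T.1 x).
rewrite -[X in _ = _ + delta x X]/(a *: (- jtriple v u y) + T.2 y).
rewrite delta_lin1 delta_lin2.
suff -> : jcomm (delta u v) (delta x y) = delta (jtriple u v x) y + delta x (- jtriple v u y).
  by rewrite scalerDr addrACA.
have tN2 b c d : jtriple b (- c) d = - jtriple b c d.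
  by have := jtriple_lin2 b d (-1) c 0; rewrite !scaleN1r addr0 => ->;
     have := jtriple_lin2 b d (-1) 0 0; rewrite scaler0 addr0 scaleN1r addNr => ->; rewrite addr0.
have tN3 b c d : jtriple b c (- d) = - jtriple b c d.
  by have := jtriple_lin3 b c (-1) d 0; rewrite !scaleN1r addr0 => ->;
     have := jtriple_lin3 b c (-1) 0 0; rewrite scaler0 addr0 scaleN1r addNr => ->; rewrite addr0.
have tN1 b c d : jtriple (- b) c d = - jtriple b c d by rewrite jtripleC tN3 jtripleC.
apply: (f_equal2 pair); apply/funext => z.
- rewrite -[LHS]/(jtriple u v (jtriple x y z) - jtriple x y (jtriple u v z)).
  rewrite -[RHS]/(jtriple (jtriple u v x) y z + jtriple x (- jtriple v u y) z).
  by rewrite jtriple_pair tN2.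
- rewrite -[LHS]/(- jtriple v u (- jtriple y x z) - - jtriple y x (- jtriple v u z)).
  rewrite -[RHS]/(- jtriple y (jtriple u v x) z + - jtriple (- jtriple v u y) x z).
  have := jtriple_pair v u y x z; rewrite !tN3 tN1 !opprK => ->; zmod.
Qed.

Lemma jcomm_span (S T : jend) : lin_span ider_gen S -> lin_span ider_gen T -> lin_span ider_gen (jcomm S T).
Proof.
move=> hS hT; have [l1 l2] := span_linear hS.
elim: {T} hT => [|a _ T [x y] _ IH].
  suff -> : jcomm S 0 = 0 by exact: span_0.
  have := jcomm_lin2 (-1) 0 0 l1 l2.
  by rewrite scaler0 addr0 scaleN1r addNr.
rewrite jcomm_lin2 // jcomm_delta // scalerDr; apply: spanD => //.
by apply: spanD; apply/spanZ/span_gen/Ider_gen.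
Qed.

End Half.

End TKK.

(* The sum of J^+, ider(J) and J^-. The hypothesis is recorded in the type since
   it is needed for ider(J) to be closed under the commutator. *)
Definition TKK (k : comPzRingType) (h2 : nat_invertible k 2) (J : jordanAlgType k) : Type :=
  (J * ider J * J)%type.

Section TKKLie.
Variables (k : comPzRingType) (h2 : nat_invertible k 2) (J : jordanAlgType k).

Local Ltac zmod := AbelianGroup.solve_in J.

Lemma ider_commP (S T : ider J) :
  jcomm (ider_val S) (ider_val T) \in in_span (@ider_gen k J).
Proof.
by case: S T => S hS [T hT]; apply/asboolP/jcomm_span => //; apply/asboolP.
Qed.

Definition ider_comm (S T : ider J) : ider J := Ider (ider_commP S T).

Local Notation TKK := (TKK h2 J).

HB.instance Definition _ := GRing.Lmodule.on TKK.

Implicit Types X Y Z : TKK.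

Definition tkk_pos X : J := X.1.1.
Definition tkk_der X : ider J := X.1.2.
Definition tkk_neg X : J := X.2.

Definition act_pos (T : ider J) (x : J) : J := (ider_val T).1 x.
Definition act_neg (T : ider J) (y : J) : J := (ider_val T).2 y.

Definition tkk_bracket X Y : TKK :=
  ((act_pos (tkk_der X) (tkk_pos Y) - act_pos (tkk_der Y) (tkk_pos X),
    ider_comm (tkk_der X) (tkk_der Y)
      + ider_delta (tkk_pos X) (tkk_neg Y) - ider_delta (tkk_pos Y) (tkk_neg X)),
   act_neg (tkk_der X) (tkk_neg Y) - act_neg (tkk_der Y) (tkk_neg X)).

Lemma act_pos_lin T : linear (act_pos T).
Proof. by case: T => T hT; have /asboolP/span_linear[] := hT. Qed.
Lemma act_neg_lin T : linear (act_neg T).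
Proof. by case: T => T hT; have /asboolP/span_linear[] := hT. Qed.
Lemma act_pos_linT a (S T : ider J) x :
  act_pos (a *: S + T) x = a *: act_pos S x + act_pos T x.
Proof. by []. Qed.
Lemma act_neg_linT a (S T : ider J) x :
  act_neg (a *: S + T) x = a *: act_neg S x + act_neg T x.
Proof. by []. Qed.

Lemma ider_comm_lin1 T : linear (ider_comm ^~ T).
Proof.
move=> a S S'; apply: val_inj; apply: jcomm_lin1; [exact: act_pos_lin|exact: act_neg_lin].
Qed.
Lemma ider_comm_lin2 T : linear (ider_comm T).
Proof.
move=> a S S'; apply: val_inj; apply: jcomm_lin2; [exact: act_pos_lin|exact: act_neg_lin].
Qed.
Lemma ider_commC S T : ider_comm S T = - ider_comm T S.
Proof. by apply: val_inj; exact: jcommC. Qed.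

Let lincombB (V : lmodType k) (a : k) (x y z w : V) :
  (a *: x + y) - (a *: z + w) = a *: (x - z) + (y - w).
Proof. by rewrite !scalerDr scalerN; AbelianGroup.solve_in V. Qed.

Let lincomb3 (V : lmodType k) (a : k) (x y z w u v : V) :
  (a *: x + y) + (a *: u + v) - (a *: z + w) = a *: (x + u - z) + (y + v - w).
Proof. by rewrite !scalerDr scalerN; AbelianGroup.solve_in V. Qed.

Fact tkk_linl Y : linear (tkk_bracket ^~ Y).
Proof.
case: Y => [[x T] y] a [[x1 T1] y1] [[x2 T2] y2].
apply: (f_equal2 pair); first apply: (f_equal2 pair).
- rewrite /tkk_der /tkk_pos /= [act_pos (_ + _) _]act_pos_linT act_pos_lin.
  exact: lincombB.
- rewrite /tkk_der /tkk_pos /tkk_neg /= ider_comm_lin1 ider_delta_lin1 ider_delta_lin2.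
  exact: lincomb3.
- rewrite /tkk_der /tkk_neg /= [act_neg (_ + _) _]act_neg_linT act_neg_lin.
  exact: lincombB.
Qed.

Lemma tkk_bracketC X Y : tkk_bracket X Y = - tkk_bracket Y X.
Proof.
apply: (f_equal2 pair); first apply: (f_equal2 pair).
- by rewrite -[RHS]/(- (_ - _)) opprB.
- rewrite ider_commC -[RHS]/(- (_ + _ - _)).
  AbelianGroup.solve_in (ider J).
- by rewrite -[RHS]/(- (_ - _)) opprB.
Qed.

Fact tkk_linr X : linear (tkk_bracket X).
Proof.
move=> a Y Y'; rewrite tkk_bracketC (tkk_bracketC X Y) (tkk_bracketC X Y').
by rewrite (tkk_linl X a Y Y') opprD scalerN.
Qed.

HB.instance Definition _ := Lmodule_isNAAlgebra.Build k TKK tkk_linl tkk_linr.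

Fact tkk_alt X : tkk_bracket X X = 0.
Proof.
apply: (f_equal2 pair); first apply: (f_equal2 pair); rewrite ?subrr //.
suff -> : ider_comm (tkk_der X) (tkk_der X) = 0 by rewrite add0r subrr.
by apply: val_inj; apply: (f_equal2 pair); apply/funext => z; rewrite /= subrr.
Qed.

Lemma ider_comm_delta (T : ider J) (x y : J) :
  ider_comm T (ider_delta x y) = ider_delta (act_pos T x) y + ider_delta x (act_neg T y).
Proof. by apply: val_inj; apply: jcomm_delta => //; case: T => T hT; apply/asboolP. Qed.

Lemma act_posB T x y : act_pos T (x - y) = act_pos T x - act_pos T y.
Proof. by have := act_pos_lin T (-1) y x; rewrite !scaleN1r => h; rewrite [x - y]addrC h addrC. Qed.
Lemma act_negB T x y : act_neg T (x - y) = act_neg T x - act_neg T y.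
Proof. by have := act_neg_lin T (-1) y x; rewrite !scaleN1r => h; rewrite [x - y]addrC h addrC. Qed.

Lemma ider_comm_jacobi S T U :
  ider_comm S (ider_comm T U) + ider_comm T (ider_comm U S) + ider_comm U (ider_comm S T) = 0.
Proof.
apply: val_inj; apply: (f_equal2 pair); apply/funext => z.
- rewrite -[LHS]/((act_pos S (act_pos T (act_pos U z) - act_pos U (act_pos T z))
      - (act_pos T (act_pos U (act_pos S z)) - act_pos U (act_pos T (act_pos S z))))
    + (act_pos T (act_pos U (act_pos S z) - act_pos S (act_pos U z))
      - (act_pos U (act_pos S (act_pos T z)) - act_pos S (act_pos U (act_pos T z))))
    + (act_pos U (act_pos S (act_pos T z) - act_pos T (act_pos S z))
      - (act_pos S (act_pos T (act_pos U z)) - act_pos T (act_pos S (act_pos U z))))).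
  rewrite -[RHS]/(0 : J) !act_posB; zmod.
- rewrite -[LHS]/((act_neg S (act_neg T (act_neg U z) - act_neg U (act_neg T z))
      - (act_neg T (act_neg U (act_neg S z)) - act_neg U (act_neg T (act_neg S z))))
    + (act_neg T (act_neg U (act_neg S z) - act_neg S (act_neg U z))
      - (act_neg U (act_neg S (act_neg T z)) - act_neg S (act_neg U (act_neg T z))))
    + (act_neg U (act_neg S (act_neg T z) - act_neg T (act_neg S z))
      - (act_neg S (act_neg T (act_neg U z)) - act_neg T (act_neg S (act_neg U z))))).
  rewrite -[RHS]/(0 : J) !act_negB; zmod.
Qed.

Let comm3 (T A B C : ider J) : ider_comm T (A + B - C) = ider_comm T A + ider_comm T B - ider_comm T C.
Proof.
have h1 := ider_comm_lin2 T 1 A B; have h3 := ider_comm_lin2 T (-1) C (A + B).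
rewrite !scale1r in h1; rewrite !scaleN1r in h3.
by rewrite [A + B - C]addrC h3 h1 addrC.
Qed.

Let deltaB1 (x x' y : J) : ider_delta (x - x') y = ider_delta x y - ider_delta x' y.
Proof.
by have := ider_delta_lin1 y (-1) x' x; rewrite /= !scaleN1r => h; rewrite [x - x']addrC h addrC.
Qed.

Let deltaB2 (x y y' : J) : ider_delta x (y - y') = ider_delta x y - ider_delta x y'.
Proof.
by have := ider_delta_lin2 x (-1) y' y; rewrite !scaleN1r => h; rewrite [y - y']addrC h addrC.
Qed.

Fact tkk_jacobi X Y Z : tkk_bracket X (tkk_bracket Y Z) + tkk_bracket Y (tkk_bracket Z X)
  + tkk_bracket Z (tkk_bracket X Y) = 0.
Proof.
case: X Y Z => [[x1 T1] y1] [[x2 T2] y2] [[x3 T3] y3].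
have posE (S T : ider J) (x y x' y' w : J) : act_pos (ider_comm S T + ider_delta x y - ider_delta x' y') w =
  act_pos S (act_pos T w) - act_pos T (act_pos S w) + jtriple x y w - jtriple x' y' w by [].
have negE (S T : ider J) (x y x' y' w : J) : act_neg (ider_comm S T + ider_delta x y - ider_delta x' y') w =
  act_neg S (act_neg T w) - act_neg T (act_neg S w) + - jtriple y x w - - jtriple y' x' w by [].
apply: (f_equal2 pair); first apply: (f_equal2 pair).
- rewrite -[RHS]/(0 : J) /tkk_der /tkk_pos /tkk_neg /= !posE !act_posB.
  rewrite (jtripleC x2 y3 x1) (jtripleC x3 y1 x2) (jtripleC x1 y2 x3); zmod.
- rewrite -[RHS]/(0 : ider J) /tkk_der /tkk_pos /tkk_neg /= !comm3 !ider_comm_delta.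
  rewrite !deltaB1 !deltaB2 -(ider_comm_jacobi T1 T2 T3).
  AbelianGroup.solve_in (ider J).
- rewrite -[RHS]/(0 : J) /tkk_der /tkk_pos /tkk_neg /= !negE !act_negB.
  rewrite (jtripleC y3 x2 y1) (jtripleC y1 x3 y2) (jtripleC y2 x1 y3); zmod.
Qed.

HB.instance Definition _ := NAAlgebra_isLie.Build k TKK tkk_alt tkk_jacobi.

End TKKLie.

Section ExteriorSquare.
Variables (k : comPzRingType) (M : lmodType k).

Inductive alt_rel : tensor M M -> Prop := Alt_rel x : alt_rel (x ⊗ x).

Definition ext2 : Type := quot_module alt_rel.

HB.instance Definition _ := GRing.Lmodule.on ext2.

Definition wedge (x y : M) : ext2 := qpi alt_rel (x ⊗ y).

End ExteriorSquare.

Section UCE.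
Variables (k : comPzRingType) (L : lieAlgType k).

Inductive uce_rel : ext2 L -> Prop := Uce_rel x y z :
  uce_rel (wedge x (y ** z) + wedge y (z ** x) + wedge z (x ** y)).

Definition uce : Type := quot_module uce_rel.

HB.instance Definition _ := GRing.Lmodule.on uce.

Definition uce_class (x y : L) : uce := qpi uce_rel (wedge x y).

(* The linear map with uce_map (uce_class x y) = [x, y], see uce_mapE. *)
Definition uce_map : uce -> L := qlift (qlift (tlift (fun x y : L => x ** y))).

Lemma lie_bilinear : bilinear_map (fun x y : L => x ** y).
Proof. by split=> n; [exact: amul_linl|exact: amul_linr]. Qed.

Lemma wedge_bilinear : bilinear_map (@wedge k L).
Proof.
split=> [n a m m'|m a n n'] /=; rewrite /wedge -qpi_linear.
  by rewrite tensZDl.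
by rewrite tensZDr.
Qed.

Lemma uce_class_bilinear : bilinear_map uce_class.
Proof.
split=> [n a m m'|m a n n'] /=; rewrite /uce_class -qpi_linear.
  by rewrite -(wedge_bilinear.1 n a m m').
by rewrite -(wedge_bilinear.2 m a n n').
Qed.

Lemma alt_rel0 t : alt_rel t -> tlift (fun x y : L => x ** y) t = 0.
Proof. by case=> x; rewrite tliftE; [exact: lie_alt|exact: lie_bilinear]. Qed.

Lemma ext2_lift_linear : linear (qlift (tlift (fun x y : L => x ** y)) : ext2 L -> L).
Proof. by apply: qlift_linear; [exact/tlift_linear/lie_bilinear|exact: alt_rel0]. Qed.

Lemma ext2_liftE (x y : L) :
  qlift (tlift (fun x y : L => x ** y)) (wedge x y) = x ** y.
Proof.
rewrite /wedge qliftE; [|exact/tlift_linear/lie_bilinear|exact: alt_rel0].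
by rewrite tliftE //; exact: lie_bilinear.
Qed.

Lemma uce_rel0 t : uce_rel t -> qlift (tlift (fun x y : L => x ** y)) t = 0.
Proof.
case=> x y z; have D a b : qlift (tlift (fun x y : L => x ** y)) (a + b : ext2 L) =
    qlift (tlift (fun x y : L => x ** y)) a + qlift (tlift (fun x y : L => x ** y)) b.
  by have := ext2_lift_linear 1 a b; rewrite !scale1r.
by rewrite !D !ext2_liftE; exact: lie_jacobi.
Qed.

Lemma uce_map_linear : linear uce_map.
Proof. by apply: qlift_linear; [exact: ext2_lift_linear|exact: uce_rel0]. Qed.

Lemma uce_mapE x y : uce_map (uce_class x y) = x ** y.
Proof.
rewrite /uce_map /uce_class qliftE; first exact: ext2_liftE.
  exact: ext2_lift_linear.
exact: uce_rel0.
Qed.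

Definition uce_bracket (X Y : uce) : uce := uce_class (uce_map X) (uce_map Y).

Fact uce_linl Y : linear (uce_bracket ^~ Y).
Proof. by move=> a X X'; rewrite /uce_bracket uce_map_linear (uce_class_bilinear.1 (uce_map Y)). Qed.

Fact uce_linr X : linear (uce_bracket X).
Proof. by move=> a Y Y'; rewrite /uce_bracket uce_map_linear (uce_class_bilinear.2 (uce_map X)). Qed.

HB.instance Definition _ := Lmodule_isNAAlgebra.Build k uce uce_linl uce_linr.

Fact qpi_rel0 (V : lmodType k) (S : V -> Prop) v : S v -> qpi S v = 0.
Proof.
move=> Sv; have -> : (0 : quot_module S) = qpi S 0.
  by have := qpi_linear S (-1) 0 0; rewrite scaler0 addr0 scaleN1r addNr.
by apply/qpiP; rewrite subr0; exact: span_gen.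
Qed.

Fact uce_alt X : uce_bracket X X = 0.
Proof.
rewrite /uce_bracket /uce_class /wedge [qpi _ (_ ⊗ _)]qpi_rel0; last exact: Alt_rel.
by have := qpi_linear uce_rel (-1) 0 0; rewrite scaler0 addr0 scaleN1r addNr.
Qed.

Fact uce_jacobi X Y Z : uce_bracket X (uce_bracket Y Z) + uce_bracket Y (uce_bracket Z X)
  + uce_bracket Z (uce_bracket X Y) = 0.
Proof.
rewrite /uce_bracket !uce_mapE /uce_class -(qpiD uce_rel) -(qpiD uce_rel).
by apply: qpi_rel0; exact: Uce_rel.
Qed.

HB.instance Definition _ := NAAlgebra_isLie.Build k uce uce_alt uce_jacobi.

End UCE.

Definition centrally_closed (k : comPzRingType) (L : lieAlgType k) : Prop :=
  alg_isomorphism (@uce_map k L : uce L -> L).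

(* Main.v *)
From HB Require Import structures.
Require Import Defs.
From mathcomp Require Import all_boot all_order all_algebra ring.
From mathcomp Require Import all_classical.

Set Implicit Arguments.
Unset Strict Implicit.
Unset Printing Implicit Defensive.

Import GRing.Theory.
Local Open Scope ring_scope.

(* With the grading element zeta = delta(1, 1) / 2, the Jacobi identity in uce(TKK J)
   shows that every element is <zeta, a> + <b, zeta> + sum_i <x_i, y_i> with a, x_i in
   J^+ and b, y_i in J^-; it is in the kernel of u iff a = b = 0 and
   sum_i delta(x_i, y_i) = 0. By faithful flatness the vanishing of sum_i <x_i, y_i> can
   be tested after base change, that is, for the split Albert algebra.

   There J has a basis of 27 weight vectors e_i of E_6, and J ⊗ J^* is the sum of modules
   of ranks 1, 78 and 650, the last one being the kernel of delta. Antisymmetry of the bracket gives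
     <{x y u}, v> - <u, {y x v}> + <{u v x}, y> - <x, {v u y}> = 0,
   which makes the inner derivations, hence their Casimir operator, kill <b> for
   b in the kernel of delta; so <x, y> only depends on delta(x, y). Explicitly,
     3888 <x, y> = 648 sum_l <delta(x, y) e_l, e_l^*> - 16 tr(delta(x, y)) sum_l <e_l, e_l^*>
   with 3888 = 2^4 3^5. On basis vectors both sides are integer combinations of the
   <e_i, e_j>, and their difference is an explicit integer combination of instances of the
   displayed relation. *)

(** * Integral structure constants and certificates *)

Section Comb.
Variable T : eqType.
Fixpoint add_term (p : int * T) (s : seq (int * T)) :=
  if s is q :: s' then
    if q.2 == p.2 then (p.1 + q.1, q.2) :: s' else q :: add_term p s'
  else [:: p].
(** A normal form: a combination that cancels over the integers becomes the empty list. *)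
Definition collect (s : seq (int * T)) : seq (int * T) :=
  [seq p <- foldr add_term [::] s | p.1 != 0].
Definition scale_comb (a : int) (s : seq (int * T)) := [seq (a * p.1, p.2) | p <- s].
End Comb.

(* Bilinear products are encoded by lists of entries (n, (i, j, l)), each standing for a
   term n x_i y_j of the l-th coordinate of xy. Octonions have the 8 coordinates
   alpha_1, u_0, u_1, u_2, x_0, x_1, x_2, alpha_2. *)
Definition oct_table : seq (int * (nat * nat * nat)) :=
  [:: (1, (0, 0, 0)%N); (1, (7, 7, 7)%N)] ++
  flatten [seq let i1 := (i.+1 %% 3)%N in let i2 := (i.+2 %% 3)%N in
    [:: (- 1, (1 + i, 4 + i, 0)%N); (- 1, (4 + i, 1 + i, 7)%N);
        (1, (0, 1 + i, 1 + i)%N); (1, (1 + i, 7, 1 + i)%N);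
        (1, (4 + i1, 4 + i2, 1 + i)%N); (- 1, (4 + i2, 4 + i1, 1 + i)%N);
        (1, (4 + i, 0, 4 + i)%N); (1, (7, 4 + i, 4 + i)%N);
        (1, (1 + i1, 1 + i2, 4 + i)%N); (- 1, (1 + i2, 1 + i1, 4 + i)%N)] | i <- iota 0 3].

(* Coordinates 0, 1, 2 of the Albert algebra are the diagonal entries; slots 0, 1, 2
   are the octonion entries at (1, 2), (2, 0), (0, 1). *)
Definition slot (s c : nat) : nat :=
  match s with 0 => c.+3 | 1 => c.+4.+4.+3 | _ => c.+4.+4.+4.+4.+3 end.
Definition oct_dual (c : nat) : nat := nth 0%N [:: 7; 4; 5; 6; 1; 2; 3; 0]%N c.
Definition oct_conj (c : nat) : int * nat :=
  match c with 0 => (1, 7%N) | 7 => (1, 0%N) | _ => (- 1, c) end.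

(* The product AB + BA, which is twice the Jordan product. *)
Definition albert_table : seq (int * (nat * nat * nat)) :=
  flatten [seq let s1 := (s.+1 %% 3)%N in let s2 := (s.+2 %% 3)%N in
    (2, (s, s, s)) ::
    [seq (1, (slot s1 c, slot s1 (oct_dual c), s)) | c <- iota 0 8] ++
    [seq (1, (slot s2 c, slot s2 (oct_dual c), s)) | c <- iota 0 8] ++
    flatten [seq [:: (1, (s1, slot s c, slot s c)); (1, (s2, slot s c, slot s c));
                     (1, (slot s c, s1, slot s c)); (1, (slot s c, s2, slot s c))]
            | c <- iota 0 8] ++
    flatten [seq let: (a, (i, j, c)) := t in let: (b, c') := oct_conj c in
        [:: (a * b, (slot s1 i, slot s2 j, slot s c'));
            (a * b, (slot s2 j, slot s1 i, slot s c'))] | t <- oct_table]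
  | s <- iota 0 3].

Definition albert_prod (i j : nat) : seq (int * nat) :=
  [seq (t.1, t.2.2) | t <- albert_table & t.2.1 == (i, j)].

Definition prod_array := [seq [seq albert_prod i j | j <- iota 0 27] | i <- iota 0 27].

Definition look2 (tb : seq (seq (seq (int * nat)))) i j := nth [::] (nth [::] tb i) j.

Definition mul_comb tb (i : nat) (s : seq (int * nat)) : seq (int * nat) :=
  flatten [seq scale_comb p.1 (look2 tb i p.2) | p <- s].

(* The coordinates of 2 {e_i e_j e_k}. *)
Definition triple_comb tb (i j k : nat) : seq (int * nat) :=
  collect (mul_comb tb i (look2 tb j k) ++ mul_comb tb k (look2 tb j i) ++
           scale_comb (- 1) (mul_comb tb j (look2 tb k i))).

(* The dual basis for the trace form is a permutation of the basis. *)
Definition dual (i : nat) : nat :=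
  if (i < 3)%N then i else slot ((i - 3) %/ 8) (oct_dual ((i - 3) %% 8)).

Definition triple_array tb :=
  [seq [seq [seq triple_comb tb i j k | k <- iota 0 27] | j <- iota 0 27] | i <- iota 0 27].

Definition look3 (V : seq (seq (seq (seq (int * nat))))) i j k :=
  nth [::] (nth [::] (nth [::] V i) j) k.

Section Certificate.
(* V i j l lists the coordinates of 2 {e_i e_j e_l}, and (i, j) : nat * nat stands for
   <e_i, e_j>. *)
Variable V : nat -> nat -> nat -> seq (int * nat).

(** Twice the antisymmetry relation at four basis vectors, because [V] holds doubled triple
    products. *)
Definition relation x y u v : seq (int * (nat * nat)) :=
  [seq (p.1, (p.2, v)) | p <- V x y u] ++ [seq (- p.1, (u, p.2)) | p <- V y x v] ++
  [seq (p.1, (p.2, y)) | p <- V u v x] ++ [seq (- p.1, (x, p.2)) | p <- V v u y].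

(* The entry (n, (x, y, u, v)) stands for n times the relation at e_x, e_y, e_u, e_v. If
   e_j = e_i^* the weight of <e_i, e_j> is zero, and the relations are between pairs of
   opposite root vectors. If the weight is not a root then delta(e_i, e_j) = 0, and
   <e_i, e_i^*> acts on <e_i, e_j> by the invertible scalar 2. If it is a root, the
   relations with <e_l, e_l^*> identify <e_i, e_j>, up to sign, with the other five
   <e_i', e_j'> of the same weight. *)
Definition certificate i j :
    seq (int * (nat * nat * nat * nat)) :=
  if j == dual i then
    flatten [seq (if V i j w is [::] then
       flatten [seq (if V i (dual m) w is p :: _ then [:: (- 9 * p.1, (i, dual m, w, dual p.2))] else [::])
       | m <- iota 0 27] else [::])
     | w <- iota 0 27]
  else
    let s := [seq l <- iota 0 27 | V i j l != [::]] in
    if s is [::] then [:: (972, (i, j, i, dual i))]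
    else [seq (- 324, (i, j, l, dual l)) | l <- s].

Definition trace_comb i j : int :=
  foldr +%R 0 (flatten [seq [seq p.1 | p <- V i j l & p.2 == l] | l <- iota 0 27]).

(** The coefficients 324 here and 8 in [trace_part] are half of 648 and 16, since [V] is doubled.
    With J ⊗ J^* identified with End(J), the map x ⊗ y -> delta(x, y) is 0 on the part of rank 650,
    6 on that of rank 78 and 18 on the identity; the constants fit as 6 * 648 = 18 * (648 - 27 * 16)
    = 3888. *)
Definition factor_part i j : seq (int * (nat * nat)) :=
  flatten [seq [seq (- 324 * p.1, (p.2, dual l)) | p <- V i j l] | l <- iota 0 27].

Definition trace_part i j : seq (int * (nat * nat)) :=
  let t := 8 * trace_comb i j in [seq (t, (l, dual l)) | l <- iota 0 27].

Definition relation_part i j : seq (int * (nat * nat)) :=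
  flatten [seq let: (a, (x, y, u, v)) := t in scale_comb (- a) (relation x y u v)
          | t <- certificate i j].

Definition residue i j : seq (int * (nat * nat)) :=
  collect ((3888, (i, j)) :: factor_part i j ++ trace_part i j ++ relation_part i j).

End Certificate.

(** The table is an argument and [V] a partial application to the array of triples, so that
    call-by-value evaluation computes products and triples only once. *)
Definition certificate_valid tb :=
  let V := look3 (triple_array tb) in
  all (fun i => all (fun j => nilp (residue V i j)) (iota 0 27)) (iota 0 27).

(** One integer identity for each of the 729 pairs of basis vectors; being integral, it can be used
    over every ring. *)
Lemma certificate_valid_true : certificate_valid prod_array = true.
Proof. by vm_compute. Qed.

Lemma nth_array (T : Type) (x0 : T) (f : nat -> T) n i :
  nth x0 [seq f j | j <- iota 0 n] i = if (i < n)%N then f i else x0.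
Proof.
have [lt_in|le_ni] := ltnP i n; last by rewrite nth_default // size_map size_iota.
by rewrite (nth_map 0%N) ?size_iota // nth_iota.
Qed.

(** * Unbundled linear maps and values of integer combinations *)

Section LinearMaps.
Variables (k : comPzRingType) (U V : lmodType k) (f : U -> V).
Hypothesis lf : linear f.

Let F : {linear U -> V} := HB.pack f (GRing.isLinear.Build k U V *:%R f lf).

Lemma lin_sum I (r : seq I) (P : pred I) (G : I -> U) :
  f (\sum_(i <- r | P i) G i) = \sum_(i <- r | P i) f (G i).
Proof. exact: (raddf_sum F). Qed.
Lemma lin_0 : f 0 = 0. Proof. exact: (raddf0 F). Qed.
Lemma lin_D x y : f (x + y) = f x + f y. Proof. exact: (raddfD F). Qed.
Lemma lin_N x : f (- x) = - f x. Proof. exact: (raddfN F). Qed.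
Lemma lin_B x y : f (x - y) = f x - f y. Proof. exact: (raddfB F). Qed.
Lemma lin_Mn n x : f (x *+ n) = f x *+ n. Proof. exact: (raddfMn F). Qed.
Lemma lin_Mz n x : f (x *~ n) = f x *~ n. Proof. exact: (raddfMz F). Qed.
Lemma lin_Z a x : f (a *: x) = a *: f x. Proof. exact: (linearZZ F). Qed.

End LinearMaps.

Section CombValue.
Variables (V : zmodType) (T : eqType) (g : T -> V).
Implicit Types s : seq (int * T).

Definition comb_val s : V := \sum_(p <- s) g p.2 *~ p.1.

Lemma comb_val_nil : comb_val [::] = 0.
Proof. by rewrite /comb_val big_nil. Qed.

Lemma comb_val_cons p s : comb_val (p :: s) = g p.2 *~ p.1 + comb_val s.
Proof. by rewrite /comb_val big_cons. Qed.

Lemma comb_val_cat s s' : comb_val (s ++ s') = comb_val s + comb_val s'.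
Proof. by rewrite /comb_val big_cat. Qed.

Lemma comb_val_flatten (I : Type) (r : seq I) (h : I -> seq (int * T)) :
  comb_val (flatten [seq h i | i <- r]) = \sum_(i <- r) comb_val (h i).
Proof. by rewrite /comb_val big_flatten big_map. Qed.

Lemma comb_val_scale a s : comb_val (scale_comb a s) = comb_val s *~ a.
Proof.
rewrite /comb_val big_map mulrz_suml; apply: eq_bigr => p _ /=.
by rewrite mulrC mulrzA.
Qed.

Lemma comb_val_collect s : comb_val (collect s) = comb_val s.
Proof.
have -> : comb_val (collect s) = comb_val (foldr (@add_term T) [::] s).
  rewrite /comb_val big_filter [RHS](bigID (fun p => p.1 != 0)) /=.
  rewrite [X in _ = _ + X]big1 ?addr0 // => p /negPn/eqP ->.
  by rewrite mulr0z.
elim: s => [|p s IH]; first by rewrite /comb_val big_nil.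
rewrite /= comb_val_cons -{}IH; move: (foldr _ _ s) => {}s.
elim: s => [|q s IH] //=; first by rewrite comb_val_cons.
case: eqP => [e|_]; rewrite !comb_val_cons /=; last by rewrite IH addrCA.
by rewrite e mulrzDr addrA.
Qed.

End CombValue.

Lemma lin_comb (k : comPzRingType) (U V : lmodType k) (f : U -> V) (T : eqType)
    (g : T -> U) s : linear f -> f (comb_val g s) = comb_val (f \o g) s.
Proof.
by move=> lf; rewrite lin_sum //; apply: eq_bigr => p _; rewrite lin_Mz.
Qed.

(** * Triple products and the antisymmetry relation *)

Section NATriple.
Variables (k : comPzRingType) (A : naAlgType k).
Implicit Types x y z : A.

(* jtriple without the Jordan axioms, since base_change phi J only comes with
   the structure of a naAlgType. *)
Definition natriple x y z : A := (x ** (y ** z) + z ** (y ** x) - y ** (z ** x)) *+ 2.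

Local Ltac zmod := AbelianGroup.solve_in A.

Lemma natriple_lin1 y z : linear (fun x => natriple x y z).
Proof.
move=> a x x'; rewrite /natriple !(amulDl, amulDr, amulZl, amulZr) !mulr2n.
by rewrite !(scalerDr, scalerN); zmod.
Qed.

Lemma natriple_lin2 x z : linear (fun y => natriple x y z).
Proof.
move=> a y y'; rewrite /natriple !(amulDl, amulDr, amulZl, amulZr) !mulr2n.
by rewrite !(scalerDr, scalerN); zmod.
Qed.

Lemma natriple_lin3 x y : linear (natriple x y).
Proof.
move=> a z z'; rewrite /natriple !(amulDl, amulDr, amulZl, amulZr) !mulr2n.
by rewrite !(scalerDr, scalerN); zmod.
Qed.

End NATriple.

Lemma amul_bilinear (k : comPzRingType) (M N : lmodType k) (A : naAlgType k)
    (f : M -> A) (g : N -> A) :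
  linear f -> linear g -> bilinear_map (fun x y => f x ** g y).
Proof. by move=> lf lg; split=> [n|m] a x y; rewrite ?lf ?lg ?amul_linl ?amul_linr. Qed.

Section TripleDefect.
Variables (k : comPzRingType) (A : naAlgType k) (P : lmodType k) (B : A -> A -> P).
Hypothesis bB : bilinear_map B.

(** For [B x y] = <x, y> in uce(TKK J) this is <delta(x, y), delta(u, v)> + <delta(u, v), delta(x,
    y)>. *)
Definition triple_defect x y u v : P :=
  B (natriple x y u) v - B u (natriple y x v) + B (natriple u v x) y - B x (natriple v u y).

Let n1 (a b c d : A) : natriple (a + b) c d = natriple a c d + natriple b c d.
Proof. exact: lin_D (natriple_lin1 c d) a b. Qed.
Let n2 (a b c d : A) : natriple c (a + b) d = natriple c a d + natriple c b d.
Proof. exact: lin_D (natriple_lin2 c d) a b. Qed.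
Let n3 (a b c d : A) : natriple c d (a + b) = natriple c d a + natriple c d b.
Proof. exact: lin_D (natriple_lin3 c d) a b. Qed.
Let d1 a b c : B (a + b) c = B a c + B b c.
Proof. exact: lin_D (bB.1 c) a b. Qed.
Let d2 a b c : B c (a + b) = B c a + B c b.
Proof. exact: lin_D (bB.2 c) a b. Qed.

Lemma triple_defectD1 x x' y u v :
  triple_defect (x + x') y u v = triple_defect x y u v + triple_defect x' y u v.
Proof. by rewrite /triple_defect !(n1, n2, n3, d1, d2); AbelianGroup.solve_in P. Qed.
Lemma triple_defectD2 x y y' u v :
  triple_defect x (y + y') u v = triple_defect x y u v + triple_defect x y' u v.
Proof. by rewrite /triple_defect !(n1, n2, n3, d1, d2); AbelianGroup.solve_in P. Qed.
Lemma triple_defectD3 x y u u' v :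
  triple_defect x y (u + u') v = triple_defect x y u v + triple_defect x y u' v.
Proof. by rewrite /triple_defect !(n1, n2, n3, d1, d2); AbelianGroup.solve_in P. Qed.
Lemma triple_defectD4 x y u v v' :
  triple_defect x y u (v + v') = triple_defect x y u v + triple_defect x y u v'.
Proof. by rewrite /triple_defect !(n1, n2, n3, d1, d2); AbelianGroup.solve_in P. Qed.

End TripleDefect.

(** The vectors vanish from index 27 on, matching the empty default entries of the tables, so that
    table lookups are correct at all indices. Products are doubled to have integer coordinates. *)
Definition albert_basis (K : comPzRingType) (A : naAlgType K) (e : nat -> A)
    (co : nat -> A -> K) : Prop :=
  [/\ forall i, (27 <= i)%N -> e i = 0,
      forall i, linear (co i : A -> K^o),
      forall i l, (l < 27)%N -> co l (e i) = (l == i)%:R,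
      forall x, x = \sum_(i <- iota 0 27) co i x *: e i &
      forall i j, (i < 27)%N -> (j < 27)%N -> (e i ** e j) *+ 2 = comb_val e (albert_prod i j)].

(** * Factorisation of a bilinear map through the triple product *)

Section Factor.
Variables (K : comPzRingType) (A : naAlgType K) (e : nat -> A) (co : nat -> A -> K).
Hypothesis he : albert_basis e co.
Variables (P : lmodType K) (B : A -> A -> P).
Hypothesis bB : bilinear_map B.
Hypothesis BR : forall x y u v, triple_defect B x y u v = 0.

Let b (p : nat * nat) : P := B (e p.1) (e p.2).

Lemma look2_prod i j : (e i ** e j) *+ 2 = comb_val e (look2 prod_array i j).
Proof.
have [e0 _ _ _ hm] := he; rewrite /look2 nth_array.
have [i27|i27] := ltnP i 27; last by rewrite nth_nil e0 // amul0l mul0rn comb_val_nil.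
rewrite nth_array; have [j27|j27] := ltnP j 27; first exact: hm.
by rewrite (e0 j) // amul0r mul0rn comb_val_nil.
Qed.

Lemma mul_combE i s : comb_val e (mul_comb prod_array i s) = (e i ** comb_val e s) *+ 2.
Proof.
rewrite comb_val_flatten lin_sum; last exact: amul_linr.
rewrite -sumrMnl; apply: eq_bigr => p _.
rewrite comb_val_scale -look2_prod lin_Mz; last exact: amul_linr.
by rewrite !pmulrn -!mulrzA mulrC.
Qed.

Let V := look3 (triple_array prod_array).

Lemma triple_combE i j l :
  comb_val e (triple_comb prod_array i j l) = natriple (e i) (e j) (e l) *+ 2.
Proof.
rewrite comb_val_collect !comb_val_cat comb_val_scale !mul_combE -!look2_prod.
have amulMn x y n : x ** (y *+ n) = (x ** y) *+ n :> A by apply/lin_Mn/amul_linr.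
by rewrite !amulMn mulrN1z -!mulrnBl -!mulrnDl addrA.
Qed.

Lemma look3_triple i j l : comb_val e (V i j l) = natriple (e i) (e j) (e l) *+ 2.
Proof.
have [e0 _ _ _ _] := he; rewrite /V /look3 nth_array.
have [i27|i27] := ltnP i 27; last first.
  by rewrite !nth_nil (e0 i) // (lin_0 (natriple_lin1 _ _)) mul0rn comb_val_nil.
rewrite nth_array; have [j27|j27] := ltnP j 27; last first.
  by rewrite !nth_nil (e0 j) // (lin_0 (natriple_lin2 _ _)) mul0rn comb_val_nil.
rewrite nth_array; have [l27|l27] := ltnP l 27; first exact: triple_combE.
by rewrite (e0 l) // (lin_0 (natriple_lin3 _ _)) mul0rn comb_val_nil.
Qed.

Lemma relationE x y u v : comb_val b (relation V x y u v) = 0.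
Proof.
have lB n : linear (B ^~ n) by case: bB.
have rB m : linear (B m) by case: bB.
have e1 w s : comb_val b [seq (p.1, (p.2, w)) | p <- s] = B (comb_val e s) (e w).
  by rewrite (lin_comb _ _ (lB _)) /comb_val big_map.
have e2 w s : comb_val b [seq (- p.1, (w, p.2)) | p <- s] = - B (e w) (comb_val e s).
  rewrite (lin_comb _ _ (rB _)) /comb_val big_map -sumrN.
  by apply: eq_bigr => p _ /=; rewrite mulrNz.
rewrite !comb_val_cat !e1 !e2 !look3_triple.
have lB2 w x' y' z' : B (natriple x' y' z' *+ 2) w = B (natriple x' y' z') w *+ 2.
  exact: lin_Mn (lB w) _ _.
have rB2 w x' y' z' : B w (natriple x' y' z' *+ 2) = B w (natriple x' y' z') *+ 2.
  exact: lin_Mn (rB w) _ _.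
rewrite !lB2 !rB2.
have E (p q r s : P) : p - q + r - s = 0 -> p *+ 2 + (- (q *+ 2) + (r *+ 2 - s *+ 2)) = 0.
  by move=> h; rewrite -[RHS](mul0rn _ 2) -h !(mulrnBl, mulrnDl) !addrA.
exact: E (BR _ _ _ _).
Qed.

Definition diag_sum : P := \sum_(l <- iota 0 27) b (l, dual l).

(** Defined for every map [F], so that [factor (natriple x y)] depends on x and y only through the
    map z -> {x y z}. *)
Definition factor (F : A -> A) : P :=
  (\sum_(l <- iota 0 27) B (F (e l) *+ 2) (e (dual l))) *+ 324
  - ((\sum_(l <- iota 0 27) co l (F (e l) *+ 2)) *: diag_sum) *+ 8.

Lemma trace_combE i j :
  \sum_(l <- iota 0 27) co l (natriple (e i) (e j) (e l) *+ 2) = (trace_comb V i j)%:~R.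
Proof.
have [_ co_lin co_e _ _] := he.
rewrite /trace_comb; have -> s : foldr +%R 0 s = \sum_(n <- s) n :> int.
  by elim: s => [|n s IH]; rewrite ?big_nil ?big_cons //= IH.
rewrite big_flatten big_map rmorph_sum [LHS]big_seq [RHS]big_seq; apply: eq_bigr => l.
rewrite mem_iota => /andP[_ l27].
rewrite -look3_triple (lin_comb _ _ (co_lin l)) big_map big_filter rmorph_sum /=.
rewrite [LHS](bigID (fun p => p.2 == l)) /= [X in _ + X]big1 => [|p /negPf np].
  by rewrite addr0; apply: eq_bigr => p /eqP ->; rewrite co_e // eqxx.
by rewrite co_e // eq_sym np mul0rz.
Qed.

(** The residue of the certificate is the empty combination and its relation part has value 0 by
    [relationE]; what remains is this identity. *)
Lemma factor_basis i j : (i < 27)%N -> (j < 27)%N ->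
  B (e i) (e j) *+ 3888 = factor (natriple (e i) (e j)).
Proof.
move=> i27 j27.
have /allP/(_ i) := certificate_valid_true; rewrite mem_iota => /(_ i27) /allP/(_ j).
rewrite mem_iota => /(_ j27) /nilP; rewrite -/V => r0.
have : comb_val b (residue V i j) = 0 by rewrite r0 /comb_val big_nil.
rewrite comb_val_collect comb_val_cons (comb_val_cat _ (factor_part V i j)).
rewrite (comb_val_cat _ (trace_part V i j)).
have -> : comb_val b (relation_part V i j) = 0.
  rewrite comb_val_flatten big1 // => [[a [[[x y] u] v]]] _.
  by rewrite comb_val_scale relationE mul0rz.
rewrite addr0 => /eqP; rewrite addr_eq0 => /eqP.
rewrite -[_ *~ _]/(B (e i) (e j) *+ 3888) => ->; rewrite opprD /factor trace_combE.
congr (_ + _).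
  rewrite comb_val_flatten -sumrN -sumrMnl; apply: eq_bigr => l _.
  rewrite -look3_triple (lin_comb _ _ (bB.1 _)) /comb_val big_map -sumrN -sumrMnl.
  by apply: eq_bigr => p _; rewrite mulNr mulrNz opprK mulrC mulrzA.
congr (- _); rewrite /comb_val big_map scaler_int /diag_sum.
by rewrite mulrz_suml -sumrMnl; apply: eq_bigr => l _; rewrite mulrC mulrzA.
Qed.

Lemma factorD F G : factor (fun z => F z + G z) = factor F + factor G.
Proof.
have [_ co_lin _ _ _] := he.
rewrite /factor addrACA -mulrnDl -opprD -mulrnDl -scalerDl -!big_split /=.
congr (_ *+ _ - _ *: _ *+ _); apply: eq_bigr => l _.
  by rewrite mulrnDl (lin_D (bB.1 _)).
by rewrite mulrnDl (lin_D (co_lin _)).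
Qed.

Lemma factorZ a F : factor (fun z => a *: F z) = a *: factor F.
Proof.
have [_ co_lin _ _ _] := he.
have e1 l : B ((a *: F (e l)) *+ 2) (e (dual l)) = a *: B (F (e l) *+ 2) (e (dual l)).
  by rewrite scalerMnr (lin_Z (bB.1 _)).
have e2 l : co l ((a *: F (e l)) *+ 2) = a * co l (F (e l) *+ 2).
  by rewrite scalerMnr (lin_Z (co_lin _)).
rewrite /factor (eq_bigr _ (fun l _ => e1 l)) (eq_bigr _ (fun l _ => e2 l)).
by rewrite -scaler_sumr -mulr_sumr -scalerA scalerBr !scalerMnr.
Qed.

Lemma eq_factor F G : F =1 G -> factor F = factor G.
Proof. by move=> FG; congr (_ *+ _ - _ *: _ *+ _); apply: eq_bigr => l _; rewrite FG. Qed.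

Lemma factor_sum (I : Type) (r : seq I) (F : I -> A -> A) :
  factor (fun z => \sum_(i <- r) F i z) = \sum_(i <- r) factor (F i).
Proof.
elim: r => [|i r IH].
  rewrite big_nil -[RHS](scale0r (factor (fun=> 0))) -factorZ; apply: eq_factor => z.
  by rewrite big_nil scale0r.
by rewrite big_cons -IH -factorD; apply: eq_factor => z; rewrite big_cons.
Qed.

(** Both sides are bilinear in x and y, which reduces the claim to [factor_basis]. *)
Lemma factorP x y : B x y *+ 3888 = factor (natriple x y).
Proof.
have [_ _ _ sp _] := he.
rewrite {1}(sp x) (lin_sum (bB.1 _)) -sumrMnl.
rewrite (eq_factor (G := fun z => \sum_(i <- iota 0 27) co i x *: natriple (e i) y z)); last first.
  move=> z; rewrite {1}(sp x) (lin_sum (natriple_lin1 _ _)).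
  by apply: eq_bigr => i _; rewrite (lin_Z (natriple_lin1 _ _)).
rewrite factor_sum [LHS]big_seq [RHS]big_seq; apply: eq_bigr => i; rewrite mem_iota => /andP[_ i27].
rewrite factorZ (lin_Z (bB.1 _)) scalerMnr; congr (_ *: _).
rewrite {1}(sp y) (lin_sum (bB.2 _)) -sumrMnl.
rewrite (eq_factor (G := fun z => \sum_(j <- iota 0 27) co j y *: natriple (e i) (e j) z)); last first.
  move=> z; rewrite {1}(sp y) (lin_sum (natriple_lin2 _ _)).
  by apply: eq_bigr => j _; rewrite (lin_Z (natriple_lin2 _ _)).
rewrite factor_sum [LHS]big_seq [RHS]big_seq; apply: eq_bigr => j; rewrite mem_iota => /andP[_ j27].
by rewrite factorZ (lin_Z (bB.2 _)) scalerMnr factor_basis.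
Qed.

(** By [factorP] the left side is [factor] of the zero map. *)
Lemma sum_eq0_of_triple (r : seq (A * A)) :
  (forall z, \sum_(p <- r) natriple p.1 p.2 z = 0) -> (\sum_(p <- r) B p.1 p.2) *+ 3888 = 0.
Proof.
move=> r0; rewrite -sumrMnl (eq_bigr (fun p => factor (natriple p.1 p.2))) => [|p _]; last exact: factorP.
rewrite -factor_sum -[RHS](scale0r (factor (fun=> 0))) -factorZ; apply: eq_factor => z.
by rewrite r0 scale0r.
Qed.

End Factor.

(** * Coordinates of the split Albert algebra *)

Definition o0 : 'I_3 := @Ordinal 3 0 isT.
Definition o1 : 'I_3 := @Ordinal 3 1 isT.
Definition o2 : 'I_3 := @Ordinal 3 2 isT.

Lemma sum3 (V : nmodType) (F : 'I_3 -> V) : \sum_i F i = F o0 + (F o1 + F o2).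
Proof.
by rewrite !big_ord_recl big_ord0 addr0; congr (F _ + (F _ + F _)); apply: val_inj.
Qed.

Lemma ord3P (Q : 'I_3 -> Prop) : Q o0 -> Q o1 -> Q o2 -> forall i, Q i.
Proof.
move=> q0 q1 q2 [[|[|[|//]]] h].
- by have -> : Ordinal h = o0 by exact: val_inj.
- by have -> : Ordinal h = o1 by exact: val_inj.
- by have -> : Ordinal h = o2 by exact: val_inj.
Qed.

Section OctonionCoordinates.
Variable K : comPzRingType.
Local Notation O := (octonion K).

Definition oct_co (c : nat) (z : O) : K :=
  match c with
  | 0 => oa1 z
  | 1 => ou z 0 o0 | 2 => ou z 0 o1 | 3 => ou z 0 o2
  | 4 => ox z 0 o0 | 5 => ox z 0 o1 | 6 => ox z 0 o2
  | _ => oa2 z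
  end.

Definition oct_of (f : nat -> K) : O :=
  Oct (f 0%N) (\row_i f (1 + i)%N) (\row_i f (4 + i)%N) (f 7%N).

Lemma oct_co_of c f : (c < 8)%N -> oct_co c (oct_of f) = f c.
Proof. by do 8?case: c => [|c] //=; rewrite ?/ou ?/ox /= ?mxE. Qed.

Lemma oct_co_ext z w : (forall c, (c < 8)%N -> oct_co c z = oct_co c w) -> z = w.
Proof.
move=> h; apply: octP; [exact: (h 0%N)| | |exact: (h 7%N)]; apply/rowP; apply: ord3P.
- exact: (h 1%N). - exact: (h 2%N). - exact: (h 3%N).
- exact: (h 4%N). - exact: (h 5%N). - exact: (h 6%N).
Qed.

Lemma oct_co_linear c : linear (oct_co c : O -> K^o).
Proof. by move=> a z w; do 8?case: c => [|c] //=; rewrite ?/ou ?/ox /= !mxE. Qed.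

Lemma oct_coD c (z w : O) : oct_co c (z + w) = oct_co c z + oct_co c w.
Proof. exact: lin_D (oct_co_linear c) z w. Qed.

Lemma oct_co_sum c I (r : seq I) (F : I -> O) :
  oct_co c (\sum_(i <- r) F i) = \sum_(i <- r) oct_co c (F i).
Proof. exact: (big_morph _ (oct_coD c) (lin_0 (oct_co_linear c))). Qed.

Lemma oct_co_conj c z : (c < 8)%N ->
  oct_co c (oconj z) = oct_co (oct_conj c).2 z *~ (oct_conj c).1.
Proof. by rewrite oconjE; do 8?case: c => [|c] //=; rewrite ?/ou ?/ox /= ?mxE. Qed.

Lemma oct_co_scalar c a : (c < 8)%N ->
  oct_co c (a *: oone K) = if (c == 0)%N || (c == 7)%N then a else 0.
Proof.
move=> c8; rewrite (lin_Z (oct_co_linear c)).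
by do 8?case: c c8 => [|c] c8 //=; rewrite ?/ou ?/ox /= ?mxE ?[_ *: _]mulr0 ?[_ *: _]mulr1.
Qed.

Lemma crossp3 (u v : 'rV[K]_3) :
  [/\ crossp u v 0 o0 = u 0 o1 * v 0 o2 - u 0 o2 * v 0 o1,
      crossp u v 0 o1 = u 0 o2 * v 0 o0 - u 0 o0 * v 0 o2 &
      crossp u v 0 o2 = u 0 o0 * v 0 o1 - u 0 o1 * v 0 o0].
Proof.
by split; rewrite mxE; congr (u 0 _ * v 0 _ - u 0 _ * v 0 _); apply: val_inj.
Qed.

(** Confirms [oct_table] against the matrix definition of the octonion product, one coordinate at a
    time. *)
Lemma oct_co_mul c z w : (c < 8)%N ->
  oct_co c (z ** w) =
  \sum_(t <- oct_table | t.2.2 == c) (oct_co t.2.1.1 z * oct_co t.2.1.2 w) *~ t.1.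
Proof.
have [x0 x1 x2] := crossp3 (ox z) (ox w); have [u0 u1 u2] := crossp3 (ou z) (ou w).
have h1 : oa1 (z ** w) = oa1 z * oa1 w - dotp (ou z) (ox w) by [].
have h2 : oa2 (z ** w) = oa2 z * oa2 w - dotp (ox z) (ou w) by [].
have hu i : ou (z ** w) 0 i = oa1 z * ou w 0 i + oa2 w * ou z 0 i + crossp (ox z) (ox w) 0 i.
  by rewrite [LHS]mxE; congr (_ + _); rewrite !mxE.
have hx i : ox (z ** w) 0 i = oa1 w * ox z 0 i + oa2 z * ox w 0 i + crossp (ou z) (ou w) 0 i.
  by rewrite [LHS]mxE; congr (_ + _); rewrite !mxE.
rewrite /dotp !sum3 in h1 h2.
rewrite -big_filter; set T := seq.filter _ _ => c8.
(* All coefficients in [oct_table] are 1 or -1; these two facts turn the integer multiples into ring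
   expressions. *)
have N1 (r : K) : r *~ Negz 0 = - r by exact: mulrN1z.
have P1 (r : K) : r *~ Posz 1 = r by [].
do 8?[case: c c8 @T => [|c] c8 T; first by vm_compute in (value of T);
  rewrite /T !big_cons big_nil /= !(N1, P1) ?h1 ?h2 ?hu ?hx ?x0 ?x1 ?x2 ?u0 ?u1 ?u2; ring].
by [].
Qed.

End OctonionCoordinates.

(** * Coordinates of Hermitian octonion matrices and of their Jordan product *)

Section SplitAlbertBasis.
Variable K : comPzRingType.
Local Notation O := (octonion K).
Local Notation S := (split_albert K).
Implicit Types x y : S.

Definition split8 (T : Type) (f g : nat -> T) (m : nat) : T :=
  if m is n.+4.+4 then g n else f m.

Definition albert_co (l : nat) x : K :=
  let M := albert_mx x in
  match l with
  | 0 => oa1 (M o0 o0) | 1 => oa1 (M o1 o1) | 2 => oa1 (M o2 o2)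
  | m.+3 => split8 (fun c => oct_co c (M o1 o2))
      (split8 (fun c => oct_co c (M o2 o0)) (fun c => oct_co c (M o0 o1))) m
  end.

Definition albert_mx_of (f : nat -> K) : octmx K := fun i j =>
  let X s := oct_of (fun c => f (slot s c)) in
  match val i, val j with
  | 0, 0 => f 0%N *: oone K | 0, 1 => X 2%N | 0, _ => oconj (X 1%N)
  | 1, 0 => oconj (X 2%N) | 1, 1 => f 1%N *: oone K | 1, _ => X 0%N
  | _, 0 => X 1%N | _, 1 => oconj (X 0%N) | _, _ => f 2%N *: oone K
  end.

Lemma oconj_scalar (a : K) : oconj (a *: oone K) = a *: oone K.
Proof. by rewrite oconjE; apply: octP; rewrite /ou /ox //= scaler0 oppr0. Qed.

Lemma albert_mx_of_hermitian f : albert_mx_of f \in @oct_hermitian K.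
Proof.
apply/asboolP; split.
  by apply: ord3P; apply: ord3P; rewrite /albert_mx_of /= ?oconj_scalar ?oconjK.
by apply: ord3P; [exists (f 0%N)|exists (f 1%N)|exists (f 2%N)].
Qed.

Definition albert_of f : S := SplitAlbert (albert_mx_of_hermitian f).

Lemma albert_co_of f l : (l < 27)%N -> albert_co l (albert_of f) = f l.
Proof.
have d (a : K) : oa1 (a *: oone K) = a by exact: mulr1.
case: l => [|[|[|l]]]; rewrite /= ?d // => l24.
rewrite /split8; do 8?[case: l l24 => [|l] l24; first by rewrite oct_co_of].
do 8?[case: l l24 => [|l] l24; first by rewrite oct_co_of].
by do 8?[case: l l24 => [|l] l24; first by rewrite oct_co_of].
Qed.

Lemma albert_mx_conj x i j : albert_mx x j i = oconj (albert_mx x i j).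
Proof. by case: x => X hX; have /asboolP[h _] := hX; rewrite /= h. Qed.

Lemma albert_mx_diag x i : albert_mx x i i = oa1 (albert_mx x i i) *: oone K.
Proof.
case: x => X hX; have /asboolP[_ h] := hX; rewrite /=; have [c ->] := h i.
by congr (_ *: _); apply: esym; exact: mulr1.
Qed.

(** A Hermitian matrix is determined by its diagonal scalars and its entries at (1, 2), (2, 0), (0,
    1); the other entries are conjugates of these. *)
Lemma albert_co_ext x y : (forall l, (l < 27)%N -> albert_co l x = albert_co l y) -> x = y.
Proof.
move=> h; apply: val_inj; apply/funext => i; apply/funext => j.
have h12 : albert_mx x o1 o2 = albert_mx y o1 o2.
  by apply: oct_co_ext => c c8; have := h (3 + c)%N; rewrite /=;
     do 8?case: c c8 => [|c] c8 //; apply.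
have h20 : albert_mx x o2 o0 = albert_mx y o2 o0.
  by apply: oct_co_ext => c c8; have := h (11 + c)%N; rewrite /=;
     do 8?case: c c8 => [|c] c8 //; apply.
have h01 : albert_mx x o0 o1 = albert_mx y o0 o1.
  by apply: oct_co_ext => c c8; have := h (19 + c)%N; rewrite /=;
     do 8?case: c c8 => [|c] c8 //; apply.
have h0 : albert_mx x o0 o0 = albert_mx y o0 o0.
  by rewrite albert_mx_diag [RHS]albert_mx_diag; congr (_ *: _); exact: (h 0%N).
have h1 : albert_mx x o1 o1 = albert_mx y o1 o1.
  by rewrite albert_mx_diag [RHS]albert_mx_diag; congr (_ *: _); exact: (h 1%N).
have h2 : albert_mx x o2 o2 = albert_mx y o2 o2.
  by rewrite albert_mx_diag [RHS]albert_mx_diag; congr (_ *: _); exact: (h 2%N).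
move: i j; apply: ord3P; apply: ord3P => //.
- by rewrite [LHS]albert_mx_conj [RHS]albert_mx_conj h20.
- by rewrite [LHS]albert_mx_conj [RHS]albert_mx_conj h01.
- by rewrite [LHS]albert_mx_conj [RHS]albert_mx_conj h12.
Qed.

Lemma albert_co_linear l : linear (albert_co l : S -> K^o).
Proof.
move=> a x y; case: l => [|[|[|l]]] //=.
rewrite /split8; do 8?[case: l => [|l]; first exact: oct_co_linear].
do 8?[case: l => [|l]; first exact: oct_co_linear].
exact: oct_co_linear.
Qed.

Definition albert_gen (i : nat) : S := albert_of (fun l => (l == i)%:R).

Lemma albert_co_gen i l : (l < 27)%N -> albert_co l (albert_gen i) = (l == i)%:R.
Proof. exact: albert_co_of. Qed.

(** When 2 is invertible, [inv2 K] is its inverse and is cancelled by the doubling. *)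
Lemma albert_mulE x y : nat_invertible K 2 ->
  albert_mx ((x ** y) *+ 2) =
  omxmul (albert_mx x) (albert_mx y) + omxmul (albert_mx y) (albert_mx x).
Proof.
case=> c hc; have h2 : inv2 K * 2%:R = 1.
  by rewrite /inv2; case: xgetP => [d _ //|h]; case: (h c hc).
rewrite mulr2n -[LHS]/(omxjordan (albert_mx x) (albert_mx y) + omxjordan (albert_mx x) (albert_mx y)).
by rewrite -mulr2n -scaler_nat scalerA mulrC h2 scale1r.
Qed.

(** Entries are read from a coordinate function instead of a matrix, so that coordinates of products
    become polynomials in the values of such functions. *)
Definition entry_co (f : nat -> K) (i j : 'I_3) (c : nat) : K :=
  let scalar a := match c with 0 | 7 => a | _ => 0 end in
  let conj s := f (slot s (oct_conj c).2) *~ (oct_conj c).1 in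
  match nat_of_ord i, nat_of_ord j with
  | 0, 0 => scalar (f 0%N) | 0, 1 => f (slot 2 c) | 0, _ => conj 1%N
  | 1, 0 => conj 2%N | 1, 1 => scalar (f 1%N) | 1, _ => f (slot 0 c)
  | _, 0 => f (slot 1 c) | _, 1 => conj 0%N | _, _ => scalar (f 2%N)
  end.

Lemma oct_co_entry x i j c : (c < 8)%N ->
  oct_co c (albert_mx x i j) = entry_co (albert_co^~ x) i j c.
Proof.
move=> c8; have h2 a : oct_co c (a *: oone K) = match c with 0 | 7 => a | _ => 0 end.
  by rewrite oct_co_scalar //; do 8?case: c c8 => [|c] c8 //.
have h3 s : oct_co c (oconj (oct_of (fun c => albert_co (slot s c) x))) =
    albert_co (slot s (oct_conj c).2) x *~ (oct_conj c).1.
  have d8 : ((oct_conj c).2 < 8)%N by clear -c8; do 8?case: c c8 => [|c] c8 //.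
  by rewrite oct_co_conj // (oct_co_of _ d8).
have -> : albert_mx x = albert_mx_of (albert_co^~ x).
  rewrite [in LHS](_ : x = albert_of (albert_co^~ x)) //.
  by apply: albert_co_ext => l l27; rewrite albert_co_of.
by move: i j; apply: ord3P; apply: ord3P;
  rewrite /albert_mx_of /entry_co ?h2 ?h3 ?oct_co_of.
Qed.

(** Table entries are grouped by target coordinate and stored evaluated, so that sums over them
    unfold into explicit polynomials. *)
Definition oct_rows :=
  Eval vm_compute in [seq [seq t <- oct_table | t.2.2 == c] | c <- iota 0 8].
Definition albert_rows :=
  Eval vm_compute in [seq [seq t <- albert_table | t.2.2 == l] | l <- iota 0 27].

Definition entry_product (f g : nat -> K) i j c : K :=
  foldr (fun m s => foldr (fun t s =>
    entry_co f i m t.2.1.1 * entry_co g m j t.2.1.2 *~ t.1 + s) s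
      (nth [::] oct_rows c)) 0 [:: o0; o1; o2].

Lemma oct_co_entry_product x y i j c : (c < 8)%N ->
  oct_co c (omxmul (albert_mx x) (albert_mx y) i j)
  = entry_product (albert_co^~ x) (albert_co^~ y) i j c.
Proof.
move=> c8; rewrite /omxmul oct_co_sum sum3.
have e m s : foldr (fun t s => entry_co (albert_co^~ x) i m t.2.1.1
      * entry_co (albert_co^~ y) m j t.2.1.2 *~ t.1 + s) s (nth [::] oct_rows c)
    = oct_co c (albert_mx x i m ** albert_mx y m j) + s.
  rewrite oct_co_mul // -big_filter.
  have -> : [seq t <- oct_table | t.2.2 == c] = nth [::] oct_rows c.
    by have := @nth_array _ [::] (fun c => [seq t <- oct_table | t.2.2 == c]) 8 c; rewrite c8 => <-.
  have : all (fun t => (t.2.1.1 < 8)%N && (t.2.1.2 < 8)%N) (nth [::] oct_rows c).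
    by do 8?case: c c8 => [|c] c8 //.
  elim: (nth _ _ _) => [|t r IH] /=; first by rewrite big_nil add0r.
  by case/andP=> /andP[t1 t2] /IH ->; rewrite big_cons !oct_co_entry // addrA.
by rewrite /entry_product /= !e addr0.
Qed.

Definition albert_product (f g : nat -> K) (l : nat) : K :=
  let p i j c := entry_product f g i j c + entry_product g f i j c in
  match l with
  | 0 => p o0 o0 0%N | 1 => p o1 o1 0%N | 2 => p o2 o2 0%N
  | m.+3 => split8 (p o1 o2) (split8 (p o2 o0) (p o0 o1)) m
  end.

Lemma albert_co_product x y l : nat_invertible K 2 -> (l < 27)%N ->
  albert_co l ((x ** y) *+ 2) = albert_product (albert_co^~ x) (albert_co^~ y) l.
Proof.
move=> h2; have p i j c : (c < 8)%N -> oct_co c (albert_mx ((x ** y) *+ 2) i j) =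
    entry_product (albert_co^~ x) (albert_co^~ y) i j c +
    entry_product (albert_co^~ y) (albert_co^~ x) i j c.
  by move=> c8; rewrite -!oct_co_entry_product // albert_mulE // -oct_coD.
case: l => [|[|[|l]]] l27; [exact: (p o0 o0 0%N)|exact: (p o1 o1 0%N)|exact: (p o2 o2 0%N)|].
rewrite /= /split8; do 8?[case: l l27 => [|l] l27; first exact: p].
do 8?[case: l l27 => [|l] l27; first exact: p].
by do 8?[case: l l27 => [|l] l27; first exact: p].
Qed.

(** For each [l] a polynomial identity in the values of [f] and [g]; together they confirm
    [albert_table] against the matrix expression AB + BA. *)
Lemma albert_product_table f g l : (l < 27)%N ->
  albert_product f g l = foldr (fun t s => f t.2.1.1 * g t.2.1.2 *~ t.1 + s) 0 (nth [::] albert_rows l).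
Proof.
do 27?[case: l => [_|l]; first by lazy beta iota zeta delta [albert_product entry_product
  foldr nth oct_rows albert_rows split8 entry_co nat_of_ord o0 o1 o2 oct_conj slot fst snd]; ring].
by [].
Qed.

Lemma albert_co_mul x y l : nat_invertible K 2 -> (l < 27)%N ->
  albert_co l ((x ** y) *+ 2) =
  \sum_(t <- albert_table | t.2.2 == l) (albert_co t.2.1.1 x * albert_co t.2.1.2 y) *~ t.1.
Proof.
move=> h2 l27; rewrite albert_co_product // albert_product_table // -big_filter.
have -> : [seq t <- albert_table | t.2.2 == l] = nth [::] albert_rows l.
  by have := @nth_array _ [::] (fun l => [seq t <- albert_table | t.2.2 == l]) 27 l; rewrite l27 => <-.
by elim: (nth _ _ _) => [|t r IH] /=; rewrite ?big_nil // big_cons IH.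
Qed.

Lemma albert_co_sum l I (r : seq I) (Q : pred I) (F : I -> S) :
  albert_co l (\sum_(i <- r | Q i) F i) = \sum_(i <- r | Q i) albert_co l (F i).
Proof.
apply: (big_morph (albert_co l)); last exact: (lin_0 (albert_co_linear l)).
exact: (lin_D (albert_co_linear l)).
Qed.

Lemma albert_gen_basis : nat_invertible K 2 -> albert_basis albert_gen albert_co.
Proof.
move=> h2; have co0 l : albert_co l 0 = 0 by exact: (lin_0 (albert_co_linear l)).
split.
- move=> i i27; apply: albert_co_ext => l l27; rewrite co0 albert_co_gen //.
  by case: eqP => // li; move: i27; rewrite leqNgt -li l27.
- exact: albert_co_linear.
- by move=> i l l27; exact: albert_co_gen.
- move=> x; apply: albert_co_ext => l l27; rewrite albert_co_sum.
  have e i : albert_co l (albert_co i x *: albert_gen i) = albert_co i x * (l == i)%:R.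
    by rewrite -albert_co_gen //; exact: (lin_Z (albert_co_linear l)).
  rewrite (eq_bigr _ (fun i _ => e i)) (bigD1_seq l) ?iota_uniq ?mem_iota //=.
  rewrite eqxx mulr1 big1_seq ?addr0 // => i /andP[/negPf il _].
  by rewrite eq_sym il mulr0.
- move=> i j i27 j27; apply: albert_co_ext => l l27; rewrite albert_co_mul //.
  rewrite /comb_val big_map big_filter albert_co_sum big_mkcond [RHS]big_mkcond.
  (* [albert_co_gen] describes coordinates below 27, so the indices in the table have to be
     bounded. *)
  have : all (fun t => (t.2.1.1 < 27)%N && (t.2.1.2 < 27)%N) albert_table by vm_compute.
  elim: albert_table => [|[n [[a b] m]] T IH]; first by rewrite !big_nil.
  rewrite /= !big_cons /= => /andP[/andP[a27 b27] /IH ->]; congr (_ + _).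
  rewrite !albert_co_gen // (lin_Mz (albert_co_linear l)) albert_co_gen //.
  rewrite xpair_eqE eq_sym; case: eqP => _; case: eqP => _; case: eqP => _ //=;
    by rewrite ?mulr0 ?mul0r ?mulr1 ?mul0rz.
Qed.

End SplitAlbertBasis.

(** Moves the basis from the split Albert algebra to the isomorphic base change of J. *)
Lemma albert_basis_iso (K : comPzRingType) (A A' : naAlgType K) (f : A -> A') (g : A' -> A)
    (e : nat -> A') (co : nat -> A' -> K) :
  linear f -> {morph f : x y / x ** y} -> cancel f g -> cancel g f ->
  albert_basis e co -> albert_basis (g \o e) (fun l => co l \o f).
Proof.
move=> lf mf fK gK [e0 co_lin co_e sp mul]; have f_inj := can_inj fK.
split=> /=.
- by move=> i i27; apply: f_inj; rewrite gK e0 // (lin_0 lf).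
- by move=> i a x y /=; rewrite lf co_lin.
- by move=> i l l27; rewrite /= gK co_e.
- move=> x; apply: f_inj; rewrite {1}(sp (f x)) (lin_sum lf).
  by apply: eq_bigr => i _; rewrite (lin_Z lf) /= gK.
- move=> i j i27 j27; apply: f_inj; rewrite (lin_Mn lf) mf !gK mul //.
  by rewrite (lin_comb _ _ lf); apply: eq_bigr => p _; rewrite /= gK.
Qed.

(** * Base change *)

(** Scalars are absorbed into the left factor, so this induction serves the tensor product over k
    and the base change over K alike. *)
Lemma tensor_ind_add (k : comPzRingType) (M N : lmodType k) (Q : tensor M N -> Prop) :
  (forall m n, Q (m ⊗ n)) -> (forall s t, Q s -> Q t -> Q (s + t)) -> forall t, Q t.
Proof.
move=> Q1 QD; have z (n : N) : (0 : M) ⊗ n = 0 by exact: (lin_0 ((tens_bilinear M N).1 n)).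
elim/tensor_ind => [|a m n t Qt]; first by rewrite -(z 0).
by apply: QD => //; rewrite -(lin_Z ((tens_bilinear M N).1 n)).
Qed.

Section Descent.
Variables (k K : comPzRingType) (phi : {rmorphism k -> K}).
Local Notation Kk := (res_scalars phi K^o).

Lemma tmap_linear (M M' N N' : lmodType k) (f : M -> M') (g : N -> N') :
  linear f -> linear g -> linear (tmap f g).
Proof. by move=> lf lg; apply/tlift_linear/tmap_bilinear. Qed.

Lemma tmapE (M M' N N' : lmodType k) (f : M -> M') (g : N -> N') m n :
  linear f -> linear g -> tmap f g (m ⊗ n) = f m ⊗ g n.
Proof. by move=> lf lg; apply/tliftE/tmap_bilinear. Qed.

Lemma id_linear (M : lmodType k) : linear (@id M).
Proof. by []. Qed.

Section FaithfullyFlat.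
Variable M : lmodType k.
Local Notation MK := (tensor M Kk).

Let bcs (c : K) (t : MK) : MK := bc_scale (phi := phi) (V := M) c t.

Let bcs_linear c : linear (bcs c). Proof. exact: bc_scale_linear. Qed.

Let bcs_k (a : k) (t : MK) : bcs (phi a) t = a *: t.
Proof.
move: t; apply: (@tensor_ext k M Kk MK (bcs (phi a)) ( *:%R a)) => [||m r].
- exact: bcs_linear.
- by move=> b x y; rewrite scalerDr !scalerA mulrC.
by rewrite /bcs bc_scaleE -(lin_Z ((tens_bilinear M Kk).2 m)).
Qed.

Let g (x : M) : MK := x ⊗ (1 : Kk).
Let g_linear : linear g. Proof. exact: (tens_bilinear M Kk).1. Qed.
Let G : {linear M -> MK} := HB.pack g (GRing.isLinear.Build k M MK *:%R g g_linear).
Let Z : {linear M -> M} := \0.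
Let Z_linear : linear Z. Proof. by move=> a x y; rewrite /= scaler0 addr0. Qed.
Let tg := tmap_linear g_linear (@id_linear Kk).
Let tZ := tmap_linear Z_linear (@id_linear Kk).

(** The multiplication (m ⊗ r) ⊗ s -> m ⊗ sr, which by [rhoK] is a left inverse of m ⊗ s -> (m ⊗ 1)
    ⊗ s. *)
Let rho : tensor MK Kk -> MK := @tlift k MK Kk MK (fun t r => bcs r t).

Let rho_bilinear : @bilinear_map k MK Kk MK (fun t r => bcs r t).
Proof.
split=> [r|t a r s]; first exact: bcs_linear.
rewrite -(bcs_k a (bcs r t)).
have -> : bcs (a *: r + s) t = bcs (phi a * r) t + bcs s t := bc_scaleDl t (phi a * r) s.
by congr (_ + _); exact: esym (bc_scaleA (phi a) (r : K) (t : base_change phi M)).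
Qed.

Let rho_linear : linear rho. Proof. exact/tlift_linear/rho_bilinear. Qed.

Let rhoK t : rho (tmap g (@id Kk) t) = t.
Proof.
move: t; apply: (@tensor_ext k M Kk MK (fun t => rho (tmap g id t)) id) => [a x y|//|x r].
  by rewrite tg rho_linear.
rewrite (tmapE _ _ g_linear (@id_linear Kk)) /rho tliftE; last exact: rho_bilinear.
by rewrite /bcs bc_scaleE mulr1.
Qed.

(** The sequence M -> M -> M ⊗ K formed by the zero map and m -> m ⊗ 1 is exact after tensoring with
    K, where [rho] splits the second map; faithful flatness reflects exactness. *)
Lemma tens1_inj (m : M) : faithfully_flat Kk -> m ⊗ (1 : Kk) = 0 -> m = 0.
Proof.
move=> ff m0; suff : exact_at (tmap Z (@id Kk)) (tmap G (@id Kk)).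
  by move=> /(ff _ _ _ Z G)/(_ m)[h _]; have [x ->] := h m0.
move=> n; split=> [n0|[x ->]].
  exists 0; rewrite (lin_0 tZ).
  exact (etrans (esym (rhoK n)) (etrans (congr1 rho n0) (lin_0 rho_linear))).
have -> : tmap Z (@id Kk) x = 0; last exact: lin_0 tg.
move: x; apply: (@tensor_ext k M Kk MK (tmap Z id) (fun=> 0)) => [|a x y|x r]; first exact: tZ.
  by rewrite scaler0 addr0.
by rewrite (tmapE _ _ Z_linear (@id_linear Kk)); exact: (lin_0 ((tens_bilinear M Kk).1 r)).
Qed.

End FaithfullyFlat.

End Descent.

(** * The universal central extension of TKK(J) *)

Section UceTheory.
Variables (k : comPzRingType) (L : lieAlgType k).
Implicit Types x y z : L.

Lemma uce_ind (Q : uce L -> Prop) : Q 0 ->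
  (forall a x y q, Q q -> Q (a *: uce_class x y + q)) -> forall q, Q q.
Proof.
move=> Q0 QD q; have [w ->] := qpi_surj q; have [t ->] := qpi_surj w.
elim/tensor_ind: t => [|a x y t IH].
  by rewrite (lin_0 (@qpi_linear k _ (@alt_rel k L))) (lin_0 (@qpi_linear k _ (@uce_rel k L))).
by rewrite (qpi_linear (@alt_rel k L)) (qpi_linear (@uce_rel k L)); exact: QD.
Qed.

Lemma uce_class_alt x : uce_class x x = 0.
Proof.
rewrite /uce_class /wedge [qpi _ (_ ⊗ _)]qpi_rel0; last exact: Alt_rel.
exact: (lin_0 (@qpi_linear k _ (@uce_rel k L))).
Qed.

Lemma uce_classDl x y z : uce_class (x + y) z = uce_class x z + uce_class y z.
Proof. exact: lin_D ((uce_class_bilinear L).1 z) _ _. Qed.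
Lemma uce_classDr x y z : uce_class x (y + z) = uce_class x y + uce_class x z.
Proof. exact: lin_D ((uce_class_bilinear L).2 x) _ _. Qed.
Lemma uce_classZl a x y : uce_class (a *: x) y = a *: uce_class x y.
Proof. exact: lin_Z ((uce_class_bilinear L).1 y) _ _. Qed.
Lemma uce_classZr a x y : uce_class x (a *: y) = a *: uce_class x y.
Proof. exact: lin_Z ((uce_class_bilinear L).2 x) _ _. Qed.
Lemma uce_classNr x y : uce_class x (- y) = - uce_class x y.
Proof. exact: lin_N ((uce_class_bilinear L).2 x) _. Qed.
Lemma uce_classNl x y : uce_class (- x) y = - uce_class x y.
Proof. exact: lin_N ((uce_class_bilinear L).1 y) _. Qed.
Lemma uce_class0l x : uce_class 0 x = 0.
Proof. exact: lin_0 ((uce_class_bilinear L).1 x). Qed.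
Lemma uce_class0r x : uce_class x 0 = 0.
Proof. exact: lin_0 ((uce_class_bilinear L).2 x). Qed.

Lemma uce_classC x y : uce_class x y = - uce_class y x.
Proof.
apply/eqP; rewrite -addr_eq0 -(uce_class_alt (x + y)).
by rewrite uce_classDl !uce_classDr !uce_class_alt add0r addr0.
Qed.

Lemma lieC x y : x ** y = - (y ** x).
Proof.
apply/eqP; rewrite -addr_eq0 -(lie_alt (x + y)).
by rewrite amulDl !amulDr !lie_alt add0r addr0.
Qed.

Lemma uce_class_jacobi x y z :
  uce_class x (y ** z) = uce_class (x ** y) z + uce_class y (x ** z).
Proof.
have j : uce_class x (y ** z) + uce_class y (z ** x) + uce_class z (x ** y) = 0.
  by rewrite /uce_class -!(qpiD (@uce_rel k L)); apply: qpi_rel0; exact: Uce_rel.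
rewrite (uce_classC _ z) (lieC x z) uce_classNr.
by apply/eqP; rewrite -opprD -addr_eq0 -j addrA addrAC.
Qed.

Lemma uce_bracketE (q r : uce L) : q ** r = uce_class (uce_map q) (uce_map r).
Proof. by []. Qed.

End UceTheory.

(** * Grading, normal forms and kernel of the cover of TKK(J) *)

Section TKKTheory.
Variables (k : comPzRingType) (h2 : nat_invertible k 2) (J : jordanAlgType k).
Local Notation L := (TKK h2 J).
Local Notation U := (uce L).
Implicit Types (x y z u v : J) (S T : ider J).

Definition tkk_of_pos x : L := ((x, 0), 0).
Definition tkk_of_der T : L := ((0, T), 0).
Definition tkk_of_neg y : L := ((0, 0), y).

Lemma tkk_split (X : L) :
  X = tkk_of_pos (tkk_pos X) + tkk_of_der (tkk_der X) + tkk_of_neg (tkk_neg X).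
Proof.
case: X => [[x T] y]; apply: (f_equal2 pair); first apply: (f_equal2 pair);
by rewrite /= ?addr0 ?add0r.
Qed.

Lemma tkk_of_pos_linear : linear tkk_of_pos.
Proof.
by move=> a x y; apply: (f_equal2 pair); first apply: (f_equal2 pair);
  rewrite //= scaler0 addr0.
Qed.
Lemma tkk_of_neg_linear : linear tkk_of_neg.
Proof.
by move=> a x y; apply: (f_equal2 pair); first apply: (f_equal2 pair);
  rewrite //= scaler0 addr0.
Qed.
Lemma tkk_of_der_linear : linear tkk_of_der.
Proof.
by move=> a x y; apply: (f_equal2 pair); first apply: (f_equal2 pair);
  rewrite //= scaler0 addr0.
Qed.

Lemma act_pos0 x : act_pos 0 x = 0. Proof. by []. Qed.
Lemma act_neg0 x : act_neg 0 x = 0. Proof. by []. Qed.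
Lemma act_posr0 T : act_pos T 0 = 0. Proof. exact: lin_0 (act_pos_lin T). Qed.
Lemma act_negr0 T : act_neg T 0 = 0. Proof. exact: lin_0 (act_neg_lin T). Qed.
Lemma ider_comm0l T : ider_comm h2 0 T = 0. Proof. exact: lin_0 (ider_comm_lin1 h2 T). Qed.
Lemma ider_comm0r T : ider_comm h2 T 0 = 0. Proof. exact: lin_0 (ider_comm_lin2 h2 T). Qed.
Lemma ider_delta0l y : ider_delta 0 y = 0. Proof. exact: lin_0 (ider_delta_lin1 y). Qed.
Lemma ider_delta0r x : ider_delta x 0 = 0. Proof. exact: lin_0 (ider_delta_lin2 x). Qed.

Definition tkk0E := (act_pos0, act_neg0, act_posr0, act_negr0, ider_comm0l, ider_comm0r,
  ider_delta0l, ider_delta0r, subr0, sub0r, addr0, add0r, oppr0).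

Lemma tkk_bracketE (X Y : L) : X ** Y =
  ((act_pos (tkk_der X) (tkk_pos Y) - act_pos (tkk_der Y) (tkk_pos X),
    ider_comm h2 (tkk_der X) (tkk_der Y)
      + ider_delta (tkk_pos X) (tkk_neg Y) - ider_delta (tkk_pos Y) (tkk_neg X)),
   act_neg (tkk_der X) (tkk_neg Y) - act_neg (tkk_der Y) (tkk_neg X)).
Proof. by []. Qed.

Lemma tkk_pos_neg x y : tkk_of_pos x ** tkk_of_neg y = tkk_of_der (ider_delta x y).
Proof. by rewrite tkk_bracketE /tkk_of_pos /tkk_of_neg /tkk_pos /tkk_neg /tkk_der /= !tkk0E. Qed.
Lemma tkk_der_pos T x : tkk_of_der T ** tkk_of_pos x = tkk_of_pos (act_pos T x).
Proof. by rewrite tkk_bracketE /tkk_of_pos /tkk_of_der /tkk_pos /tkk_neg /tkk_der /= !tkk0E. Qed.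
Lemma tkk_der_neg T y : tkk_of_der T ** tkk_of_neg y = tkk_of_neg (act_neg T y).
Proof. by rewrite tkk_bracketE /tkk_of_neg /tkk_of_der /tkk_pos /tkk_neg /tkk_der /= !tkk0E. Qed.
Lemma tkk_der_der S T : tkk_of_der S ** tkk_of_der T = tkk_of_der (ider_comm h2 S T).
Proof. by rewrite tkk_bracketE /tkk_of_der /tkk_pos /tkk_neg /tkk_der /= !tkk0E. Qed.
Lemma tkk_pos_pos x y : tkk_of_pos x ** tkk_of_pos y = 0.
Proof. by rewrite tkk_bracketE /tkk_of_pos /tkk_pos /tkk_neg /tkk_der /= !tkk0E. Qed.
Lemma tkk_neg_neg x y : tkk_of_neg x ** tkk_of_neg y = 0.
Proof. by rewrite tkk_bracketE /tkk_of_neg /tkk_pos /tkk_neg /tkk_der /= !tkk0E. Qed.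

(** Half of delta(1, 1), because {1 1 x} = 2x; its bracket is 1, 0, -1 on J^+, ider(J), J^-. *)
Definition grading : ider J := inv2 k *: ider_delta jone jone.

Lemma inv2K (V : lmodType k) (v : V) : inv2 k *: (v *+ 2) = v.
Proof.
have [c hc] := h2; have e : inv2 k * 2%:R = 1.
  by rewrite /inv2; case: xgetP => [d _ //|h]; case: (h c hc).
by rewrite -scaler_nat scalerA e scale1r.
Qed.

Lemma jtriple11 x : jtriple jone jone x = x *+ 2.
Proof. by rewrite /jtriple !jmul1 (amulC x) jmul1 addrK. Qed.

Lemma act_pos_grading x : act_pos grading x = x.
Proof.
have -> : act_pos grading x = inv2 k *: jtriple jone jone x by [].
by rewrite jtriple11 inv2K.
Qed.
Lemma act_neg_grading y : act_neg grading y = - y.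
Proof.
have -> : act_neg grading y = inv2 k *: (- jtriple jone jone y) by [].
by rewrite jtriple11 scalerN inv2K.
Qed.

Lemma ider_comm_grading S : ider_comm h2 grading S = 0.
Proof.
apply: val_inj; apply: (f_equal2 pair); apply/funext => z.
  rewrite -[LHS]/(act_pos grading (act_pos S z) - act_pos S (act_pos grading z)).
  by rewrite !act_pos_grading subrr.
rewrite -[LHS]/(act_neg grading (act_neg S z) - act_neg S (act_neg grading z)).
by rewrite !act_neg_grading (lin_N (act_neg_lin S)) subrr.
Qed.

Definition lift_pos x : U := uce_class (tkk_of_der grading) (tkk_of_pos x).
(** The order of the arguments absorbs the eigenvalue -1 of the grading element on J^-, so that
    [uce_map] sends this to y. *)
Definition lift_neg y : U := uce_class (tkk_of_neg y) (tkk_of_der grading).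
Definition uce_delta x y : U := uce_class (tkk_of_pos x) (tkk_of_neg y).

Lemma lift_pos_linear : linear lift_pos.
Proof. by move=> a x y; rewrite /lift_pos tkk_of_pos_linear (uce_class_bilinear L).2. Qed.
Lemma lift_neg_linear : linear lift_neg.
Proof. by move=> a x y; rewrite /lift_neg tkk_of_neg_linear ((uce_class_bilinear L).1 _ a). Qed.

Lemma uce_map_pos x : uce_map (lift_pos x) = tkk_of_pos x.
Proof. by rewrite uce_mapE tkk_der_pos act_pos_grading. Qed.
Lemma uce_map_neg y : uce_map (lift_neg y) = tkk_of_neg y.
Proof.
rewrite uce_mapE lieC tkk_der_neg act_neg_grading (lin_N tkk_of_neg_linear).
exact: opprK.
Qed.
Lemma uce_map_delta x y : uce_map (uce_delta x y) = tkk_of_der (ider_delta x y).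
Proof. by rewrite uce_mapE tkk_pos_neg. Qed.

Lemma lift_pos_neg x y : lift_pos x ** lift_neg y = uce_delta x y.
Proof. by rewrite uce_bracketE uce_map_pos uce_map_neg. Qed.

(** <zeta, [x, y]> is 0 since [x, y] = 0, and is 2<x, y> by the Jacobi relation since x and y have
    degree 1. *)
Lemma uce_pos_pos x y : uce_class (tkk_of_pos x) (tkk_of_pos y) = 0 :> U.
Proof.
have := uce_class_jacobi (tkk_of_der grading) (tkk_of_pos x) (tkk_of_pos y).
rewrite tkk_pos_pos uce_class0r !tkk_der_pos !act_pos_grading => e.
by apply: (Defs.double_inj h2); rewrite -e.
Qed.

Lemma uce_neg_neg x y : uce_class (tkk_of_neg x) (tkk_of_neg y) = 0 :> U.
Proof.
have := uce_class_jacobi (tkk_of_der grading) (tkk_of_neg x) (tkk_of_neg y).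
rewrite tkk_neg_neg uce_class0r !tkk_der_neg !act_neg_grading.
rewrite !(lin_N tkk_of_neg_linear) uce_classNr uce_classNl -opprD => e.
by apply: (Defs.double_inj h2); rewrite -[LHS]opprK -e oppr0.
Qed.

(** The Jacobi relation for zeta, S, x, with [zeta, S] = 0 and [zeta, x] = x. *)
Lemma uce_der_pos S x : uce_class (tkk_of_der S) (tkk_of_pos x) = lift_pos (act_pos S x).
Proof.
rewrite /lift_pos -tkk_der_pos uce_class_jacobi tkk_der_der ider_comm_grading.
by rewrite (lin_0 tkk_of_der_linear) uce_class0l add0r tkk_der_pos act_pos_grading.
Qed.

Lemma uce_der_neg S y : uce_class (tkk_of_der S) (tkk_of_neg y) = lift_neg (act_neg S y).
Proof.
rewrite /lift_neg uce_classC -tkk_der_neg [RHS]uce_classC uce_class_jacobi tkk_der_der.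
rewrite ider_comm_grading (lin_0 tkk_of_der_linear) uce_class0l add0r tkk_der_neg.
by rewrite act_neg_grading (lin_N tkk_of_neg_linear) uce_classNr opprK -uce_classC.
Qed.

Lemma uce_der_delta S x y : uce_class (tkk_of_der S) (tkk_of_der (ider_delta x y)) =
  uce_delta (act_pos S x) y + uce_delta x (act_neg S y).
Proof. by rewrite -tkk_pos_neg uce_class_jacobi tkk_der_pos tkk_der_neg. Qed.

(** The Jacobi relation expands <delta(x, y), delta(u, v)> into the first two terms and the bracket
    with exchanged arguments into the last two; their sum vanishes by antisymmetry. *)
Lemma uce_delta_rel x y u v :
  uce_delta (jtriple x y u) v - uce_delta u (jtriple y x v)
  + uce_delta (jtriple u v x) y - uce_delta x (jtriple v u y) = 0.
Proof.
have N a b : uce_delta a (- b) = - uce_delta a b.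
  by rewrite /uce_delta (lin_N tkk_of_neg_linear) uce_classNr.
have e a b c d : uce_class (tkk_of_der (ider_delta a b)) (tkk_of_der (ider_delta c d)) =
    uce_delta (jtriple a b c) d - uce_delta c (jtriple b a d).
  rewrite uce_der_delta -N.
  by rewrite -[act_pos _ _]/(jtriple a b c) -[act_neg _ _]/(- jtriple b a d).
by rewrite -e -addrA -e [X in X + _]uce_classC addNr.
Qed.

Definition normal_form (q : U) : Prop := exists (a b : J) (s : seq (J * J)),
  q = lift_pos a + lift_neg b + \sum_(p <- s) uce_delta p.1 p.2.

Lemma normal_form_pos a : normal_form (lift_pos a).
Proof. by exists a, 0, [::]; rewrite big_nil (lin_0 lift_neg_linear) !addr0. Qed.
Lemma normal_form_neg b : normal_form (lift_neg b).
Proof. by exists 0, b, [::]; rewrite big_nil (lin_0 lift_pos_linear) add0r addr0. Qed.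
Lemma normal_form_delta x y : normal_form (uce_delta x y).
Proof.
exists 0, 0, [:: (x, y)]; rewrite big_seq1 (lin_0 lift_pos_linear).
by rewrite (lin_0 lift_neg_linear) !add0r.
Qed.
Lemma normal_form0 : normal_form 0.
Proof. by have := normal_form_pos 0; rewrite (lin_0 lift_pos_linear). Qed.
Lemma normal_formD q r : normal_form q -> normal_form r -> normal_form (q + r).
Proof.
case=> a [b [s ->]] [a' [b' [s' ->]]]; exists (a + a'), (b + b'), (s ++ s').
by rewrite big_cat (lin_D lift_pos_linear) (lin_D lift_neg_linear) [LHS]addrACA [X in X + _ = _]addrACA.
Qed.
Lemma normal_formZ c q : normal_form q -> normal_form (c *: q).
Proof.
case=> a [b [s ->]]; exists (c *: a), (c *: b), [seq (c *: p.1, p.2) | p <- s].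
rewrite big_map !scalerDr (lin_Z lift_pos_linear) (lin_Z lift_neg_linear) scaler_sumr.
congr (_ + _); apply: eq_bigr => p _.
by rewrite /uce_delta (lin_Z tkk_of_pos_linear) uce_classZl.
Qed.
Lemma normal_formN q : normal_form q -> normal_form (- q).
Proof. by move=> nq; rewrite -scaleN1r; exact: normal_formZ. Qed.

Lemma normal_form_der S T : normal_form (uce_class (tkk_of_der S) (tkk_of_der T)).
Proof.
case: T => T hT; have /asboolP sT := hT.
elim: sT hT => [|a _ T' [x y] sT IH] hT.
  have -> : Ider hT = 0 by exact: val_inj.
  by rewrite (lin_0 tkk_of_der_linear) uce_class0r; exact: normal_form0.
have hT' : T' \in in_span (@ider_gen k J) by exact/asboolP.
have -> : Ider hT = a *: ider_delta x y + Ider hT' by exact: val_inj.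
rewrite tkk_of_der_linear uce_classDr uce_classZr uce_der_delta.
by apply: normal_formD; [apply/normal_formZ/normal_formD; exact: normal_form_delta|exact: IH].
Qed.

(** Splitting both arguments of <X, Y> along the grading leaves brackets that vanish, are lifts, are
    values of [uce_delta], or reduce to these by [normal_form_der]. *)
Lemma uce_normal_form q : normal_form q.
Proof.
elim/uce_ind: q => [|a X Y q nq]; first exact: normal_form0.
apply: normal_formD => //; apply: normal_formZ.
rewrite (tkk_split X) (tkk_split Y) !(uce_classDl, uce_classDr).
rewrite uce_pos_pos uce_neg_neg !uce_der_pos !uce_der_neg.
rewrite (uce_classC (tkk_of_pos _) (tkk_of_der _)) (uce_classC (tkk_of_neg _) (tkk_of_der _)).
rewrite (uce_classC (tkk_of_neg _) (tkk_of_pos _)) uce_der_pos uce_der_neg.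
by do ![apply: normal_formD];
  rewrite ?uce_pos_pos; do ?[exact: normal_form0|apply: normal_formN];
  first [exact: normal_form_pos|exact: normal_form_neg|exact: normal_form_delta|exact: normal_form_der].
Qed.

Let uce_mapL : linear (@uce_map k L). Proof. exact: uce_map_linear. Qed.

(** The lifts reach J^+ and J^-, and ider(J) is spanned by the images of the [uce_delta x y]. *)
Lemma uce_map_surj (X : L) : exists q, uce_map q = X.
Proof.
have der T : exists q : U, uce_map q = tkk_of_der T.
  case: T => T hT; have /asboolP sT := hT.
  elim: sT hT => [|a _ T' [x y] sT IH] hT.
    exists 0; rewrite (lin_0 uce_mapL).
    by have -> : Ider hT = 0 by exact: val_inj.
  have hT' : T' \in in_span (@ider_gen k J) by exact/asboolP.
  have [q hq] := IH hT'; exists (a *: uce_delta x y + q).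
  rewrite uce_mapL uce_map_delta hq -tkk_of_der_linear.
  by congr tkk_of_der; exact: val_inj.
have [q hq] := der (tkk_der X).
exists (lift_pos (tkk_pos X) + q + lift_neg (tkk_neg X)).
rewrite !(lin_D uce_mapL) hq uce_map_pos uce_map_neg.
exact: esym (tkk_split X).
Qed.

(** The terms of a normal form map to the three summands J^+, J^- and ider(J), so each of the three
    images vanishes separately. *)
Lemma uce_ker q : uce_map q = 0 -> exists s : seq (J * J),
  q = \sum_(p <- s) uce_delta p.1 p.2 /\ forall z, \sum_(p <- s) jtriple p.1 p.2 z = 0.
Proof.
have [a [b [s ->]]] := uce_normal_form q.
rewrite !(lin_D uce_mapL) uce_map_pos uce_map_neg (lin_sum uce_mapL).
rewrite (eq_bigr _ (fun p _ => uce_map_delta p.1 p.2)) -(lin_sum tkk_of_der_linear) => e.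
have := congr1 (@tkk_pos _ h2 J) e; rewrite /tkk_pos /= !addr0 => a0.
have := congr1 (@tkk_neg _ h2 J) e; rewrite /tkk_neg /= addr0 add0r => b0.
have := congr1 (@tkk_der _ h2 J) e; rewrite /tkk_der /= !add0r => d0.
exists s; rewrite a0 b0 (lin_0 lift_pos_linear) (lin_0 lift_neg_linear) !add0r; split=> // z.
have -> : \sum_(p <- s) jtriple p.1 p.2 z = act_pos (\sum_(p <- s) ider_delta p.1 p.2) z.
  elim: (s) => [|p r IH]; first by rewrite !big_nil act_pos0.
  by rewrite !big_cons IH.
by rewrite d0 act_pos0.
Qed.

End TKKTheory.

(** * Descent from the split case *)

Lemma natriple_sumD (k : comPzRingType) (A : naAlgType k) (T : Type) (r : seq (T * T))
    (f g : T -> A) (x y : A) :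
  \sum_(p <- r) natriple (f p.1) (g p.2) (x + y) =
  \sum_(p <- r) natriple (f p.1) (g p.2) x + \sum_(p <- r) natriple (f p.1) (g p.2) y.
Proof.
by rewrite -big_split; apply: eq_bigr => p _; exact: lin_D (natriple_lin3 _ _) x y.
Qed.

Lemma nat_invertible_mul (R : comPzRingType) m n :
  nat_invertible R m -> nat_invertible R n -> nat_invertible R (m * n).
Proof. by case=> a ha [b hb]; exists (a * b); rewrite natrM mulrACA ha hb mulr1. Qed.

Lemma nat_invertible_torsion_free (R : comPzRingType) (M : lmodType R) n (v : M) :
  nat_invertible R n -> v *+ n = 0 -> v = 0.
Proof.
by case=> c hc v0; rewrite -[v]scale1r -hc -scalerA scaler_nat v0 scaler0.
Qed.

Lemma nat_invertible_morph (R R' : comPzRingType) (phi : {rmorphism R -> R'}) n :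
  nat_invertible R n -> nat_invertible R' n.
Proof. by case=> c hc; exists (phi c); rewrite -(rmorph_nat phi) -rmorphM hc rmorph1. Qed.

Section BaseChangedCover.
Variables (k : comPzRingType) (h2 : nat_invertible k 2) (J : jordanAlgType k).
Variables (K : comPzRingType) (phi : {rmorphism k -> K}).
Local Notation Kk := (res_scalars phi K^o).
Local Notation U := (uce (TKK h2 J)).

Section TmapLinear.
Variables (M N : lmodType k) (F : M -> N).
Hypothesis lF : linear F.

Definition bc_map (t : base_change phi M) : base_change phi N := tmap F (@id Kk) t.

Lemma bc_mapE m (r : Kk) : bc_map (m ⊗ r) = F m ⊗ r.
Proof. exact: tmapE lF (@id_linear k Kk). Qed.

Lemma bc_mapD s t : bc_map (s + t) = bc_map s + bc_map t.
Proof. exact: lin_D (tmap_linear lF (@id_linear k Kk)) _ _. Qed.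

Lemma bc_map_linear : linear bc_map.
Proof.
move=> c s t; rewrite bc_mapD; congr (_ + _).
rewrite -[c *: s]/(bc_scale c s) -[RHS]/(bc_scale c (bc_map s)).
move: s; apply: tensor_ind_add => [m r|s s' IH IH'].
  by rewrite bc_mapE !bc_scaleE bc_mapE.
exact: etrans (congr1 bc_map (bc_scaleDr c s s')) (etrans (bc_mapD _ _)
  (etrans (congr2 +%R IH IH') (etrans (esym (bc_scaleDr c _ _))
    (congr1 (bc_scale c) (esym (bc_mapD s s')))))).
Qed.

End TmapLinear.

(** The K-bilinear extension of [uce_delta]. Written as a product of two lifts in the base-changed
    cover, it inherits its bilinearity over K. *)
Definition bc_delta (X Y : base_change phi J) : base_change phi U :=
  bc_map (@lift_pos k h2 J) X ** bc_map (@lift_neg k h2 J) Y.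

Lemma bc_delta_bilinear : bilinear_map bc_delta.
Proof.
exact: amul_bilinear (bc_map_linear (@lift_pos_linear k h2 J))
  (bc_map_linear (@lift_neg_linear k h2 J)).
Qed.

Lemma bc_deltaE x y (r s : Kk) :
  bc_delta (x ⊗ r) (y ⊗ s) = uce_delta h2 x y ⊗ ((r : K) * s : Kk).
Proof.
rewrite /bc_delta (bc_mapE (@lift_pos_linear k h2 J)) (bc_mapE (@lift_neg_linear k h2 J)).
by rewrite -lift_pos_neg; exact: bc_mulE.
Qed.

Lemma bc_natripleE (x y z : J) (r s t : Kk) :
  natriple (x ⊗ r : base_change phi J) (y ⊗ s) (z ⊗ t) = jtriple x y z ⊗ ((r : K) * s * t : Kk).
Proof.
have m (a b : J) (p q : Kk) : (a ⊗ p : base_change phi J) ** (b ⊗ q) = (a ** b) ⊗ ((p : K) * q : Kk).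
  exact: bc_mulE.
rewrite /natriple !m.
have -> : (r : K) * ((s : K) * t) = r * s * t by ring.
have -> : (t : K) * ((s : K) * r) = r * s * t by ring.
have -> : (s : K) * ((t : K) * r) = r * s * t by ring.
pose h (a : J) : tensor J Kk := a ⊗ ((r : K) * s * t : Kk).
have lh : linear h by exact: (tens_bilinear J Kk).1.
by rewrite -[RHS]/(h _) /jtriple (lin_Mn lh) (lin_B lh) (lin_D lh).
Qed.

(** Additivity in each variable reduces this to pure tensors, where the four terms share the scalar
    abcd and [uce_delta_rel] applies. *)
Lemma bc_delta_rel (X Y V W : base_change phi J) : triple_defect bc_delta X Y V W = 0.
Proof.
move: X; apply: tensor_ind_add => [x a|X1 X2 e1 e2]; last first.
  exact: etrans (triple_defectD1 bc_delta_bilinear X1 X2 Y V W) (etrans (congr2 +%R e1 e2) (addr0 0)).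
move: Y; apply: tensor_ind_add => [y b|Y1 Y2 e1 e2]; last first.
  exact: etrans (triple_defectD2 bc_delta_bilinear _ Y1 Y2 V W) (etrans (congr2 +%R e1 e2) (addr0 0)).
move: V; apply: tensor_ind_add => [v c|V1 V2 e1 e2]; last first.
  exact: etrans (triple_defectD3 bc_delta_bilinear _ _ V1 V2 W) (etrans (congr2 +%R e1 e2) (addr0 0)).
move: W; apply: tensor_ind_add => [w d|W1 W2 e1 e2]; last first.
  exact: etrans (triple_defectD4 bc_delta_bilinear _ _ _ W1 W2) (etrans (congr2 +%R e1 e2) (addr0 0)).
rewrite /triple_defect !bc_natripleE !bc_deltaE.
have -> : (c : K) * ((b : K) * a * d) = a * b * c * d by ring.
have -> : (c : K) * d * a * b = a * b * c * d by ring.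
have -> : (a : K) * ((d : K) * c * b) = a * b * c * d by ring.
pose h (q : U) : tensor U Kk := q ⊗ ((a : K) * b * c * d : Kk).
have lh : linear h by exact: (tens_bilinear U Kk).1.
rewrite -[LHS]/(h _ - h _ + h _ - h _) -(lin_B lh) -(lin_D lh) -(lin_B lh).
by rewrite uce_delta_rel (lin_0 lh).
Qed.

Definition bc_unit (M : lmodType k) (m : M) : base_change phi M := m ⊗ (1 : Kk).

Section Unit.
Variable M : lmodType k.
Implicit Type m : M.

Let lh : linear (fun m => tens m (1 : Kk)).
Proof. exact: (tens_bilinear M Kk).1. Qed.

Lemma bc_unit0 : bc_unit (0 : M) = 0. Proof. exact: lin_0 lh. Qed.
Lemma bc_unitD m m' : bc_unit (m + m') = bc_unit m + bc_unit m'.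
Proof. exact: lin_D lh m m'. Qed.
Lemma bc_unitMn m n : bc_unit (m *+ n) = bc_unit m *+ n. Proof. exact: lin_Mn lh n m. Qed.
Lemma bc_unit_sum I (r : seq I) (F : I -> M) :
  bc_unit (\sum_(i <- r) F i) = \sum_(i <- r) bc_unit (F i).
Proof. exact: (big_morph _ bc_unitD bc_unit0). Qed.

End Unit.

Lemma bc_natriple_sum0 (s : seq (J * J)) :
  (forall z, \sum_(p <- s) jtriple p.1 p.2 z = 0) ->
  forall Z, \sum_(p <- s) natriple (bc_unit p.1) (bc_unit p.2) Z = 0.
Proof.
move=> s0; apply: tensor_ind_add => [z t|Z1 Z2 e1 e2].
  pose h (a : J) : tensor J Kk := a ⊗ ((1 : K) * 1 * t : Kk).
  have lh : linear h by exact: (tens_bilinear J Kk).1.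
  have e : \sum_(p <- s) h (jtriple p.1 p.2 z) = 0 by rewrite -(lin_sum lh) s0; exact: lin_0 lh.
  by rewrite -[RHS]e; apply: eq_bigr => p _; exact: bc_natripleE.
exact: etrans (natriple_sumD s (@bc_unit J) (@bc_unit J) Z1 Z2) (etrans (congr2 +%R e1 e2) (addr0 0)).
Qed.

Lemma bc_delta_unit x y : bc_delta (bc_unit x) (bc_unit y) = bc_unit (uce_delta h2 x y).
Proof.
have e : (1 : Kk) = ((1 : K) * 1 : Kk) by rewrite /= mulr1.
by rewrite /bc_unit {3}e; exact: bc_deltaE.
Qed.

End BaseChangedCover.

Theorem proposition6p5p42 (k : comPzRingType)
  (h2 : nat_invertible k 2) (h3 : nat_invertible k 3)
  (J : jordanAlgType k) (hJ : albert_algebra J) :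
  centrally_closed (TKK h2 J).
Proof.
have [K [phi [ff [f [lf mf [g fK gK]]]]]] := hJ.
have lu : linear (@uce_map k (TKK h2 J)) by exact: uce_map_linear.
have inj q : uce_map q = 0 :> TKK h2 J -> q = 0.
  move=> /uce_ker[s [-> s0]].
  have h2K := nat_invertible_morph phi h2.
  have hb := albert_basis_iso lf mf fK gK (albert_gen_basis h2K).
  (* This number is 3888, the multiple appearing in [sum_eq0_of_triple]; it is invertible because 2
     and 3 are. *)
  apply: (nat_invertible_torsion_free (n := 2 ^ 4 * 3 ^ 5)).
    by do ![apply: nat_invertible_mul => //]; exists 1; rewrite mulr1.
  (* After base change the kernel element becomes a sum of values of [bc_delta], to which the split
     case applies. *)
  apply: (tens1_inj ff).
  rewrite -[LHS]/(bc_unit phi _) bc_unitMn bc_unit_sum.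
  rewrite (eq_bigr _ (fun p _ => esym (bc_delta_unit h2 phi p.1 p.2))).
  have := sum_eq0_of_triple hb (bc_delta_bilinear h2 J phi) (@bc_delta_rel k h2 J K phi)
    (r := [seq (bc_unit phi p.1, bc_unit phi p.2) | p <- s]).
  rewrite big_map; apply => Z; rewrite big_map; exact: bc_natriple_sum0.
split.
- exact: lu.
- by move=> X Y; rewrite [LHS]uce_mapE.
have inj' : injective (@uce_map k (TKK h2 J)).
  by move=> q r e; apply/eqP; rewrite -subr_eq0; apply/eqP/inj; rewrite (lin_B lu) e subrr.
(* Chosen preimages give a right inverse of [uce_map], which is two-sided by injectivity. *)
pose v (X : TKK h2 J) := projT1 (cid (uce_map_surj X)).
have vK : cancel v (@uce_map k (TKK h2 J)) by move=> X; rewrite /v; case: cid.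
by exists v => // q; apply: inj'; rewrite vK.
Qed.
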